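(* Let $(V,f)$ be a non-degenerate cubic space, and let $(W,g)$ be a cubic space of countable or finite dimension. Then $W$ embeds into $V$ if and only if $\mathrm{rrk}(W)\le \mathrm{rrk}(V)$ (as elements of $\mathbf{N}\cup\{\infty\}$).
   Context: Throughout, $k$ is an algebraically closed field of characteristic different from $2$ and $3$. For a $k$-vector space $V$ (of arbitrary dimension) with basis $\{v_i\}_{i\in I}$, let $x_i\in V^*$ be the dual coordinate functionals (''coordinates''). $P_n(V)$ denotes the space of degree-$n$ polynomial functions on $V$: every element of $P_n(V)$ is a unique formal, possibly infinite, $k$-linear combination of degree-$n$ monomials in the $x_i$, and can be evaluated at any $v\in V$. $P(V)=\bigoplus_{n\ge 0}P_n(V)$ is a graded ring. The strength $\mathrm{str}(f)$ of a homogeneous $f\in P_n(V)$, $n\ge 1$, is the least $s$ such that $f=\sum_{i=1}^s g_ih_i$ with $g_i,h_i$ homogeneous elements of $P(V)$ of positive degree less than $n$, and $\mathrm{str}(f)=\infty$ if no such expression exists. A cubic space is a pair $(V,f)$ with $f\in P_3(V)$; it is non-degenerate if $\mathrm{str}(f)=\infty$. An embedding $(W,g)\to(V,f)$ of cubic spaces is a $k$-linear map $\phi:W\to V$ with $f\circ\phi=g$. Let $P_2^\circ(V)\subset P_2(V)$ be the subspace of quadratic forms of finite strength and $\overline{P}_2(V)=P_2(V)/P_2^\circ(V)$. For $f\in P_3(V)$, the residual rank $\mathrm{rrk}(f)\in\mathbf{N}\cup\{\infty\}$ is the dimension of the subspace of $\overline{P}_2(V)$ spanned by the images of the formal partial derivatives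 $\partial f/\partial x_i$, $i\in I$ (computed termwise on monomials); this is independent of the basis. The residual rank of a cubic space $(V,f)$ is $\mathrm{rrk}(V)=\mathrm{rrk}(f)$. *)

(* Defs.v *)
From HB Require Import structures.
From mathcomp Require Import all_boot all_order all_algebra.
From mathcomp Require Import finmap multiset.
From Stdlib Require Import ClassicalEpsilon.

Set Implicit Arguments.
Unset Strict Implicit.
Unset Printing Implicit Defensive.

Import GRing.Theory.
Local Open Scope fset_scope.
Local Open Scope ring_scope.

Section CubicSpaces.
Variables (k : fieldType) (I : choiceType).

(* The vector space V with basis {v_i}_{i in I}: finitely supported
   coordinate functions I -> k (v = sum_i v i * v_i). *)
Definition vec := {fsfun I -> k with 0}.

Definition vlincomb (a : k) (u v : vec) : vec :=
  [fsfun x in finsupp u `|` finsupp v => a * u x + v x].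

(* Monomials in the coordinates x_i : finite multisets over I;
   the degree of m is size (enum_mset m), and m i is the exponent of x_i. *)
Definition mono := multiset I.
Definition mdeg (m : mono) : nat := size (enum_mset m).

(* Elements of P(V) (formal, possibly infinite, linear combinations of
   monomials), given by their coefficient functions. *)
Definition fpoly := mono -> k.

Definition homogp (n : nat) (f : fpoly) : Prop :=
  forall m : mono, f m != 0 -> mdeg m = n.

Definition submsets (m : mono) : seq mono :=
  undup [seq (seq_mset (mask (val t) (enum_mset m)) : mono)
        | t <- enum {: (mdeg m).-tuple bool}].

Definition mulp (g h : fpoly) : fpoly :=
  fun m => \sum_(m1 <- submsets m) g m1 * h (msetB m m1).

Definition strength_le (n : nat) (f : fpoly) (s : nat) : Prop :=
  exists (gs hs : 'I_s -> fpoly),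
    (forall i, exists a b : nat,
        [/\ (0 < a < n)%N, (0 < b < n)%N, homogp a (gs i) & homogp b (hs i)]) /\
    (forall m, f m = \sum_(i < s) mulp (gs i) (hs i) m).

Definition finite_strength (n : nat) (f : fpoly) : Prop :=
  exists s, strength_le n f s.

Definition cubic_nondeg (f : fpoly) : Prop := ~ finite_strength 3 f.

(* evaluation of f \in P_n(V) at v : only monomials supported in the
   support of v contribute *)
Definition evaln (n : nat) (f : fpoly) (v : vec) : k :=
  \sum_(m <- undup [seq (seq_mset (map val (val t)) : mono)
                   | t <- enum {: n.-tuple (finsupp v)}])
     f m * \prod_(i <- enum_mset m) v i.

Definition dpart (i : I) (f : fpoly) : fpoly :=
  fun m => (m i).+1%:R * f (msetD (msetn 1 i) m).

(* the images of df/dx_{ix j}, j < r, are linearly independent in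
   P_2(V)/P_2^o(V) *)
Definition rrk_ge (f : fpoly) (r : nat) : Prop :=
  exists ix : 'I_r -> I,
    forall c : 'I_r -> k,
      finite_strength 2 (fun m => \sum_(j < r) c j * dpart (ix j) f m) ->
      forall j, c j = 0.

(* the residual rank, as an element of N \cup {infinity}
   (None stands for infinity): the dimension of the span of the images *)
Definition is_rrk (f : fpoly) (d : option nat) : Prop :=
  match d with
  | Some r => rrk_ge f r /\ ~ rrk_ge f r.+1
  | None => forall r, rrk_ge f r
  end.

Definition rrk (f : fpoly) : option nat :=
  epsilon (inhabits None) (is_rrk f).

End CubicSpaces.

Definition le_ninf (a b : option nat) : bool :=
  match a, b with
  | _, None => true
  | None, Some _ => false
  | Some x, Some y => (x <= y)%N
  end.

Definition coord_linear (k : fieldType) (J I : choiceType)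
  (phi : vec k J -> vec k I) : Prop :=
  forall (a : k) (u v : vec k J) (i : I),
    phi (vlincomb a u v) i = a * phi u i + phi v i.

Definition cubic_embeds (k : fieldType) (J I : choiceType)
  (g : fpoly k J) (f : fpoly k I) : Prop :=
  exists phi : vec k J -> vec k I,
    coord_linear phi /\ forall w : vec k J, evaln 3 f (phi w) = evaln 3 g w.

(* Main.v *)
Require Import Defs.
From HB Require Import structures.
From mathcomp Require Import all_boot all_order all_algebra.
From mathcomp Require Import finmap multiset.
From mathcomp Require Import ring zify.
From Stdlib Require Import Classical ClassicalEpsilon.

(** Let B be the symmetric trilinear form of f and K the space of vectors x for
    which the quadratic form B(x, -, -) has finite rank, so that the residual rank
    is dim V/K.  Pulling back quadratic forms of finite rank shows that an embedding
    cannot decrease the residual rank.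

    Conversely, non-degeneracy says that f is nonzero on every subspace of finite
    codimension.  The key step solves B(o_i, v, v) = tau_i, f(v) = c in any such
    subspace, as soon as every relation sum c_i o_i in K is satisfied by the tau_i:
    choose vectors u_j, orthogonal to everything chosen before, whose values
    (B(o_i, u_j, u_j))_i span as much as possible; the quadratic equations are then
    solved by extracting square roots.  An isotropic vector with f nonzero is found
    among v + a and v - a, because f(v + a) + f(v - a) = 2 f(v), and it is used to
    adjust the value of f.

    Iterating, V contains models: if rrk V is infinite, vectors A_n and E_q on which
    f is sum_q 3 A_(nu q) E_q^2, and if rrk V = r is finite, a basis A_0 .. A_(r-1)
    of V/K and vectors E_q in K on which f is a given cubic form in the A_n plus
    terms 3 A_(nu q) E_q^2 and E_q^3.  A cubic form in countably many variables t_n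
    is a locally finite sum of such powers: write it as sum_n t_n q_n(t_n, t_(n+1), ..)
    and each q_n as a sum of products, finitely many of them when q_n has finite
    rank, and split the products into squares or cubes. *)

Set Implicit Arguments.
Unset Strict Implicit.
Unset Printing Implicit Defensive.

Import GRing.Theory.
Local Open Scope ring_scope.

(** * Subspaces of finite codimension and trilinear forms *)

Lemma closed_root (k : closedFieldType) n (a : k) : exists x, x ^+ n.+1 = a.
Proof.
have [x xE] := @solve_monicpoly k n.+1 (fun i => if i == 0%N then a else 0) isT.
exists x; rewrite xE big_ord_recl /= mulr1 big1 ?addr0 // => i _.
by rewrite mul0r.
Qed.

Section Subspaces.
Variables (k : fieldType) (V : lmodType k).

Definition lfun (l : V -> k) := forall a u v, l (a *: u + v) = a * l u + l v.

Lemma lfun0 l : lfun l -> l 0 = 0.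
Proof.
by move=> ll; have := ll 1 0 0; rewrite scaler0 addr0 mul1r => /eqP;
  rewrite -subr_eq0 opprD addrA subrr sub0r oppr_eq0 => /eqP.
Qed.

Lemma lfunZ l a u : lfun l -> l (a *: u) = a * l u.
Proof. by move=> ll; rewrite -[a *: u]addr0 ll lfun0 // addr0. Qed.

Lemma lfunD l u v : lfun l -> l (u + v) = l u + l v.
Proof. by move=> ll; rewrite -[u]scale1r ll mul1r scale1r. Qed.

Lemma lfun_sum l (T : Type) (r : seq T) (c : T -> k) (x : T -> V) :
  lfun l -> l (\sum_(i <- r) c i *: x i) = \sum_(i <- r) c i * l (x i).
Proof.
move=> ll; elim: r => [|i r IH]; first by rewrite !big_nil lfun0.
by rewrite !big_cons ll IH.
Qed.

Definition subsp (S : V -> Prop) :=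
  S 0 /\ forall a u v, S u -> S v -> S (a *: u + v).

Lemma subspZ S a u : subsp S -> S u -> S (a *: u).
Proof. by case=> S0 SL Su; rewrite -[_ *: _]addr0; apply: SL. Qed.

Lemma subspD S u v : subsp S -> S u -> S v -> S (u + v).
Proof. by case=> S0 SL Su Sv; rewrite -[u]scale1r; apply: SL. Qed.

Lemma subspB S u v : subsp S -> S u -> S v -> S (u - v).
Proof. by move=> sS Su Sv; rewrite addrC -scaleN1r; apply: sS.2. Qed.

Lemma subsp_sum S (T : eqType) (r : seq T) (x : T -> V) :
  subsp S -> (forall i, i \in r -> S (x i)) -> S (\sum_(i <- r) x i).
Proof.
move=> sS Sx; rewrite big_seq; apply: (big_ind S) => //; first exact: sS.1.
by move=> u v; apply: subspD.
Qed.

(* [cosub U]: U is a subspace of finite codimension. *)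
Inductive cosub : (V -> Prop) -> Prop :=
| cosub_full (U : V -> Prop) : (forall v, U v) -> cosub U
| cosub_cut (U U' : V -> Prop) (l : V -> k) : cosub U -> lfun l ->
    (forall v, U' v <-> U v /\ l v = 0) -> cosub U'.

Lemma cosub_subsp U : cosub U -> subsp U.
Proof.
elim=> {}U => [UT|U' l _ [U0 UL] ll U'E]; first by split.
split=> [|a u v /U'E[Uu lu] /U'E[Uv lv]]; apply/U'E; split=> //.
- exact: lfun0.
- exact: UL.
- by rewrite ll lu lv mulr0 addr0.
Qed.

Lemma cosub_ker l : lfun l -> cosub (fun v => l v = 0).
Proof.
move=> ll; apply: (@cosub_cut (fun _ => True) _ l) => //; first exact: cosub_full.
by move=> v; split=> [|[]].
Qed.

Lemma cosubI U U' : cosub U -> cosub U' -> cosub (fun v => U v /\ U' v).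
Proof.
move=> cU; elim=> {}U' => [U'T|U'' l _ IH ll U''E].
  elim: cU U'T => {}U => [UT|U0 l cU _ ll UE] U'T; first exact: cosub_full.
  by apply: (cosub_cut cU ll) => v; rewrite -UE; split=> [[]|].
apply: (cosub_cut IH ll) => v; rewrite U''E; tauto.
Qed.

Lemma cosub_ext U U' : cosub U -> (forall v, U v <-> U' v) -> cosub U'.
Proof.
move=> cU UE; have lf0 : lfun (fun _ => 0) by move=> a u v; rewrite mulr0 addr0.
by apply: (cosub_cut cU lf0) => v; rewrite -UE; split=> [|[]].
Qed.

Lemma cosub_all (T : eqType) (r : seq T) (U : T -> V -> Prop) :
  (forall t, t \in r -> cosub (U t)) -> cosub (fun v => forall t, t \in r -> U t v).
Proof.
elim: r => [|t r IH] cU; first by apply: cosub_full.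
have c1 : cosub (U t) by apply: cU; rewrite mem_head.
have c2 : cosub (fun v => forall t, t \in r -> U t v).
  by apply: IH => s sr; apply: cU; rewrite inE sr orbT.
apply: (cosub_ext (cosubI c1 c2)) => v; split=> [[Ut Ur] s|H].
  by rewrite inE => /predU1P[->//|/Ur].
by split=> [|s sr]; apply: H; rewrite inE ?eqxx ?sr ?orbT.
Qed.

(** The linear span, as an intersection of subspaces: membership is then used directly as an
    induction principle, without coefficients. *)
Definition spn (D : seq V) v :=
  forall S, subsp S -> (forall d, d \in D -> S d) -> S v.

Lemma spn_subsp D : subsp (spn D).
Proof.
split=> [S sS _|a u v Su Sv S sS SD]; first exact: sS.1.
by apply: sS.2; [apply: Su | apply: Sv].
Qed.

Lemma mem_spn D d : d \in D -> spn D d.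
Proof. by move=> dD S _; apply. Qed.

Lemma spnS D D' v : {subset D <= D'} -> spn D v -> spn D' v.
Proof. by move=> sDD' Dv S sS SD; apply: Dv => // d /sDD'/SD. Qed.

End Subspaces.

(** Dependent choice over finite prefixes: the invariant [Good] keeps a prefix extendable, and [P]
    constrains each new term against all earlier ones. *)
Lemma sequence_build (X : Type) (Good : seq X -> Prop) (P : seq X -> X -> Prop) D0 :
  Good D0 -> (forall D, Good D -> exists v, P D v /\ Good (rcons D v)) ->
  exists e : nat -> X, forall n, P (D0 ++ mkseq e n) (e n).
Proof.
move=> G0 step.
have step' (D : {D | Good D}) :
    {v | P (sval D) v /\ Good (rcons (sval D) v)}.
  by apply: constructive_indefinite_description; apply: step (svalP D).
pose next D := exist Good (rcons (sval D) (sval (step' D))) (svalP (step' D)).2.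
pose st n := iter n next (exist Good D0 G0).
pose e n := sval (step' (st n)).
have stE n : sval (st n) = D0 ++ mkseq e n.
  elim: n => [|n IH]; first by rewrite cats0.
  have -> : sval (st n.+1) = rcons (sval (st n)) (e n) by [].
  by rewrite IH mkseqS rcons_cat.
by exists e => n; rewrite -stE; have [] := svalP (step' (st n)).
Qed.

Section Trilinear.
Variables (k : fieldType) (V : lmodType k).

Definition trisym (B : V -> V -> V -> k) :=
  [/\ forall x y, lfun (fun u => B u x y), forall u v w, B u v w = B v u w
    & forall u v w, B u v w = B u w v].

Variables (B : V -> V -> V -> k) (tB : trisym B).

Lemma triC12 u v w : B u v w = B v u w. Proof. by case: tB. Qed.
Lemma triC23 u v w : B u v w = B u w v. Proof. by case: tB. Qed.
Lemma triC13 u v w : B u v w = B w v u.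
Proof. by rewrite triC12 triC23 triC12. Qed.

Lemma tril1 x y : lfun (fun u => B u x y). Proof. by case: tB. Qed.
Lemma tril2 x y : lfun (fun u => B x u y).
Proof. by move=> a u v; rewrite !(triC12 x); exact: tril1. Qed.
Lemma tril3 x y : lfun (fun u => B x y u).
Proof. by move=> a u v; rewrite !(triC13 x); exact: tril1. Qed.

Lemma quadD o u v a : B o (u + a *: v) (u + a *: v) =
  B o u u + 2%:R * a * B o u v + a ^+ 2 * B o v v.
Proof.
by rewrite addrC (tril2 o _ a v u) !(tril3 _ _ a v u) (triC23 o v u); ring.
Qed.

Lemma cubeD u v a : B (u + a *: v) (u + a *: v) (u + a *: v) =
  B u u u + 3%:R * a * B u u v + 3%:R * a ^+ 2 * B u v v + a ^+ 3 * B v v v.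
Proof.
rewrite [in X in B X]addrC (tril1 _ _ a v u) !quadD.
by rewrite (triC12 v u v) (triC13 v u u); ring.
Qed.

Lemma tri_polar u v w : 6%:R * B u v w =
  B (u + v + w) (u + v + w) (u + v + w) - B (u + v) (u + v) (u + v)
  - B (u + w) (u + w) (u + w) - B (v + w) (v + w) (v + w)
  + B u u u + B v v v + B w w w.
Proof.
have D1 x y x1 x2 : B (x + y) x1 x2 = B x x1 x2 + B y x1 x2.
  exact: lfunD (tril1 x1 x2).
have D2 x y x1 x2 : B x1 (x + y) x2 = B x1 x x2 + B x1 y x2.
  exact: lfunD (tril2 x1 x2).
have D3 x y x1 x2 : B x1 x2 (x + y) = B x1 x2 x + B x1 x2 y.
  exact: lfunD (tril3 x1 x2).
rewrite !(D1, D2, D3) !(triC23 _ v u) !(triC23 _ w u) !(triC23 _ w v).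
rewrite !(triC12 v u) !(triC12 w u) !(triC12 w v).
by rewrite !(triC23 _ v u) !(triC23 _ w u) !(triC23 _ w v); ring.
Qed.

(* For B = tri (pol3 f) this says that the derivative of f along x has finite
   strength, see [derivative_finrk]. *)
Definition finrk x := exists2 U, cosub U & forall v, U v -> B x v v = 0.

Lemma finrk_subsp : subsp finrk.
Proof.
split=> [|a u v [U cU HU] [U' cU' HU']].
  by exists (fun _ => True) => [|v _]; [exact: cosub_full | exact: (lfun0 (tril1 _ _))].
exists (fun v => U v /\ U' v) => [|x [Ux U'x]]; first exact: cosubI.
by rewrite (tril1 x x) HU // HU' // mulr0 addr0.
Qed.

(** A condition against pairs, linear in [v]. It makes [B a b v] vanish for [a], [b] in the span of
    [D], so that cross terms containing [v] only once disappear. *)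
Definition orth (D : seq V) v := forall d d', d \in D -> d' \in D -> B d d' v = 0.

Lemma orth_cosub D : cosub (orth D).
Proof.
pose r := [seq (d, d') | d <- D, d' <- D].
have := @cosub_all _ _ _ r (fun p v => B p.1 p.2 v = 0) (fun p _ => cosub_ker (tril3 p.1 p.2)).
move/cosub_ext; apply=> v; split=> [H d d' dD d'D|H _ /allpairsP[[d d'] /= [dD d'D] ->]].
  by have /= := H (d, d'); apply; apply/allpairsP; exists (d, d').
exact: H.
Qed.

Lemma orth_spn D v a b : orth D v -> spn D a -> spn D b -> B a b v = 0.
Proof.
move=> oD Da Db; apply: (Da (fun a => B a b v = 0)) => [|d dD].
  exact: cosub_subsp (cosub_ker (tril1 b v)).
apply: (Db (fun b => B d b v = 0)) => [|d' d'D]; last exact: oD.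
exact: cosub_subsp (cosub_ker (tril2 d v)).
Qed.

End Trilinear.

Lemma tri_eq (k : fieldType) (V : lmodType k) (B B' : V -> V -> V -> k) :
  trisym B -> trisym B' -> 6%:R != 0 :> k ->
  (forall v, B v v v = B' v v v) -> forall u v w, B u v w = B' u v w.
Proof.
by move=> tB tB' n6 BB' u v w; apply: (mulfI n6); rewrite !tri_polar // !BB'.
Qed.

(** * Solving quadratic equations and one cubic equation in a subspace of finite codimension *)

Section Solve.
Variables (k : closedFieldType) (V : lmodType k) (B : V -> V -> V -> k).
Hypotheses (tB : trisym B) (n2 : 2%:R != 0 :> k).

Section Quad.
Variable os : seq V.
Let n := size os.
Let q v : 'rV[k]_n := \row_i B os`_i v v.

(** The row space of [A] consists of values of [q] already attained in [U] on the span of [D]. An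
    orthogonal [v] with a value outside [A] joins [D]: the cross terms vanish, so values add, and
    scaling [v] attains every multiple of [q v]. The rank grows each time, so the process stops. *)
Lemma quad_saturate U : cosub U -> exists (A : 'M[k]_n) (D : seq V),
  (forall tau : 'rV_n, (tau <= A)%MS -> exists a, [/\ spn D a, U a & q a = tau])
  /\ (forall v, U v -> orth B (os ++ D) v -> (q v <= A)%MS).
Proof.
move=> cU; have sU := cosub_subsp cU.
pose inv (A : 'M[k]_n) D := forall tau : 'rV_n, (tau <= A)%MS ->
  exists a, [/\ spn D a, U a & q a = tau].
(* [m] bounds how often the rank of [A] can still grow. *)
suff: forall m (A : 'M[k]_n) D, (n <= \rank A + m)%N -> inv A D ->
    exists (A : 'M[k]_n) D, inv A D /\
      (forall v, U v -> orth B (os ++ D) v -> (q v <= A)%MS).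
  move=> H; apply: (H n 0 [::]); first by rewrite leq_addl.
  move=> tau; rewrite submx0 => /eqP->; exists 0; split; first exact: (spn_subsp _).1.
    exact: sU.1.
  by apply/rowP=> i; rewrite !mxE (lfun0 (tril2 tB _ _)).
elim=> [|m IH] A D rkA invA.
  exists A, D; split=> // v _ _; apply: submx_full.
  by rewrite /row_full eqn_leq rank_leq_col; rewrite addn0 in rkA.
case: (classic (forall v, U v -> orth B (os ++ D) v -> (q v <= A)%MS)) => [H|].
  by exists A, D.
move=> H; have [v Hv] := not_all_ex_not _ _ H.
have [Uv Hv'] := imply_to_and _ _ Hv; have [ov /negP qvA] := imply_to_and _ _ Hv'.
apply: (IH (A + q v)%MS (v :: D)).
  have : (\rank A < \rank (A + q v)%MS)%N.
    by apply: rank_ltmx; rewrite /ltmx addsmxSl addsmx_sub submx_refl.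
  lia.
move=> tau /sub_addsmxP[[c1 c2] /= tauE].
have [a [Da Ua qa]] := invA _ (submxMl c1 A).
(* [c2] is a 1 x 1 matrix; scaling [v] by a square root of its entry multiplies [q v] by that
   entry. *)
have [s sE] := closed_root 1 (c2 0 0).
exists (a + s *: v); split.
- apply: (subspD (spn_subsp _)); last apply: (subspZ _ (spn_subsp _)).
    by apply: spnS Da => d; rewrite inE orbC => ->.
  by apply: mem_spn; rewrite mem_head.
- by apply: (subspD sU) => //; apply: (subspZ _ sU).
rewrite tauE -qa [c2]mx11_scalar mul_scalar_mx; apply/rowP=> i; rewrite !mxE quadD //.
have Do : spn (os ++ D) os`_i by apply: mem_spn; rewrite mem_cat mem_nth.
have Da' : spn (os ++ D) a by apply: spnS Da => d; rewrite mem_cat orbC => ->.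
by rewrite (orth_spn tB ov Do Da') mulr0 addr0 sE.
Qed.

Hypothesis nd : forall U, cosub U -> exists2 v, U v & B v v v != 0.

(* If q(a) = - q(v) with a orthogonal to v, then v + a and v - a are both
   isotropic for q, and f(v + a) + f(v - a) = 2 f(v). *)
Lemma isotropic_nonzero U : cosub U ->
  exists v, [/\ U v, forall o, o \in os -> B o v v = 0 & B v v v != 0].
Proof.
move=> cU; have sU := cosub_subsp cU.
have [A [D [AP AD]]] := quad_saturate cU.
have [v [Uv ov] fv] := nd (cosubI cU (orth_cosub tB (os ++ D))).
have [a [Da Ua qa]] : exists a, [/\ spn D a, U a & q a = - q v].
  by apply: AP; rewrite eqmx_opp; apply: AD.
have Da' : spn (os ++ D) a by apply: spnS Da => d; rewrite mem_cat orbC => ->.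
have iso (e : k) : e ^+ 2 = 1 -> forall o, o \in os -> B o (v + e *: a) (v + e *: a) = 0.
  move=> e2 o oos; have Do : spn (os ++ D) o by apply: mem_spn; rewrite mem_cat oos.
  rewrite quadD // e2 (triC23 tB o v a) (orth_spn tB ov Do Da').
  have io : (index o os < n)%N by rewrite index_mem.
  move/rowP/(_ (Ordinal io)): qa; rewrite !mxE /= nth_index // => ->; ring.
have Uva (e : k) : U (v + e *: a) by apply: (subspD sU) => //; apply: (subspZ _ sU).
have Bvaa : B v a a = 0 by rewrite triC13 // (orth_spn tB ov).
case: (altP (B (v + 1 *: a) (v + 1 *: a) (v + 1 *: a) =P 0)) => f1; last first.
  by exists (v + 1 *: a); split=> //; apply: iso; rewrite expr1n.
case: (altP (B (v + (-1) *: a) (v + (-1) *: a) (v + (-1) *: a) =P 0)) => f2; last first.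
  by exists (v + (-1) *: a); split=> //; apply: iso; rewrite sqrrN expr1n.
case/negP: fv; have : 2%:R * B v v v = 0.
  move: f1 f2; rewrite !cubeD // Bvaa => f1 f2.
  by have := congr2 +%R f1 f2; rewrite addr0 => E; rewrite -[RHS]E; ring.
by move/eqP; rewrite mulf_eq0 (negPf n2).
Qed.

End Quad.

Hypothesis nd : forall U, cosub U -> exists2 v, U v & B v v v != 0.

(** Linear duality turns the condition on relations modulo K into attainability of [tau]; an
    isotropic vector then adjusts the cubic value. *)
Lemma solve_system os (tau : nat -> k) tf U : cosub U ->
  (forall c : nat -> k, finrk B (\sum_(i < size os) c i *: os`_i) ->
     \sum_(i < size os) c i * tau i = 0) ->
  exists v, [/\ U v, forall i, (i < size os)%N -> B os`_i v v = tau i & B v v v = tf].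
Proof.
move=> cU ctau; have sU := cosub_subsp cU.
have [A [D [AP AD]]] := quad_saturate os cU.
have [C CP] : exists C : 'M[k]_(size os),
    forall t : 'rV_(size os), (t <= A)%MS = (t *m C == 0).
  by exists (cokermx A) => t; rewrite submxE.
have [] := AP (\row_i tau i).
  (* If [tau] were not in the row space of [A], some column of the cokernel would kill [A] but not
     [tau]. Its entries [c] give a combination of the [os] whose quadratic form vanishes on [U] cut
     by [orth], that is, a relation in K violated by [tau]. *)
  apply/negPn/negP; rewrite CP => /matrix0Pn[i [j]]; rewrite ord1 => {i} nz.
  case/negP: nz; apply/eqP.
  pose c (i : nat) := if insub i is Some i' then C i' j else 0.
  have cE (i : 'I_(size os)) : c i = C i j by rewrite /c valK.
  rewrite mxE; transitivity (\sum_(i < size os) c i * tau i).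
    by apply: eq_bigr => i _; rewrite !mxE cE mulrC.
  apply: ctau.
  exists (fun v => U v /\ orth B (os ++ D) v); first exact: (cosubI cU (orth_cosub tB _)).
  move=> v [Uv ov]; have := AD v Uv ov; rewrite CP => /eqP/matrixP/(_ 0 j).
  rewrite !mxE => <-; rewrite (lfun_sum _ _ _ (tril1 tB v v)); apply: eq_bigr => i _.
  by rewrite !mxE cE mulrC.
move=> u [_ Uu qu].
(* With [u] among the [os], both B(u, u, v) and B(u, v, v) vanish, so f(u + s v) = f(u) + s^3 f(v),
   and a cube root gives the value [tf]. *)
have [v [[Uv ov] qv fv]] :=
  isotropic_nonzero (u :: os) nd (cosubI cU (orth_cosub tB (u :: os))).
have [s sE] := closed_root 2 ((tf - B u u u) / B v v v).
exists (u + s *: v); split.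
- by apply: (subspD sU) => //; apply: (subspZ _ sU).
- move=> i ios; rewrite quadD // qv ?inE ?mem_nth ?orbT // (ov os`_i u) ?mem_head //; last first.
    by rewrite inE mem_nth ?orbT.
  by move/rowP/(_ (Ordinal ios)): qu; rewrite !mxE /= => ->; ring.
rewrite cubeD // qv ?mem_head // ov ?mem_head // sE mulfVK //; ring.
Qed.

End Solve.

(** * Independence modulo vectors of finite rank *)

Section ModFinrk.
Variables (k : fieldType) (V : lmodType k) (B : V -> V -> V -> k).
Hypothesis tB : trisym B.

(** The span of [D] together with K, that is, the preimage of a span in V/K; [indepK] is linear
    independence in V/K. *)
Definition spnK (D : seq V) v := forall S, subsp S ->
  (forall x, finrk B x -> S x) -> (forall d, d \in D -> S d) -> S v.

Definition indepK (D : seq V) := forall c : nat -> k,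
  finrk B (\sum_(i < size D) c i *: D`_i) -> forall i, (i < size D)%N -> c i = 0.

Lemma spnK_subsp D : subsp (spnK D).
Proof.
split=> [S sS _ _|a u v Su Sv S sS SK SD]; first exact: sS.1.
by apply: sS.2; [apply: Su | apply: Sv].
Qed.

Lemma mem_spnK D d : d \in D -> spnK D d.
Proof. by move=> dD S _ _; apply. Qed.

Lemma finrk_spnK D x : finrk B x -> spnK D x.
Proof. by move=> Kx S _ SK _; apply: SK. Qed.

Lemma spnK_sub D D' v : {subset D <= D'} -> spnK D v -> spnK D' v.
Proof. by move=> sDD' Dv S sS SK SD; apply: Dv => // d /sDD'/SD. Qed.

Lemma spnK_coord D v : spnK D v ->
  exists c : nat -> k, finrk B (v - \sum_(i < size D) c i *: D`_i).
Proof.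
have sK := finrk_subsp tB.
move=> Dv; apply: (Dv (fun v => exists c : nat -> k,
  finrk B (v - \sum_(i < size D) c i *: D`_i))); [split|move=> x Kx|move=> d dD].
- by exists (fun _ => 0); rewrite big1 ?subr0 => [|i _]; [exact: sK.1 | rewrite scale0r].
- move=> a u v' [c Kc] [c' Kc']; exists (fun i => a * c i + c' i).
  suff -> : a *: u + v' - \sum_(i < size D) (a * c i + c' i) *: D`_i =
      a *: (u - \sum_(i < size D) c i *: D`_i) + (v' - \sum_(i < size D) c' i *: D`_i).
    exact: sK.2.
  rewrite scalerBr addrACA; congr (_ + _); rewrite -opprD scaler_sumr -big_split /=.
  by congr (- _); apply: eq_bigr => i _; rewrite scalerDl scalerA.
- by exists (fun _ => 0); rewrite big1 ?subr0 // => i _; rewrite scale0r.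
have dD' : (index d D < size D)%N by rewrite index_mem.
exists (fun i => (i == index d D)%:R).
rewrite (bigD1 (Ordinal dD')) //= eqxx scale1r nth_index // big1 ?addr0 ?subrr.
  exact: sK.1.
by move=> i; rewrite -val_eqE /= => /negPf->; rewrite scale0r.
Qed.

Lemma indepK_rcons D v : indepK D -> ~ spnK D v -> indepK (rcons D v).
Proof.
move=> iD Dv c; rewrite size_rcons big_ord_recr /= nth_rcons ltnn eqxx.
under eq_bigr => i _ do rewrite nth_rcons ltn_ord.
move=> Kc; have [cn0|cn0] := eqVneq (c (size D)) 0.
  move: Kc; rewrite cn0 scale0r addr0 => /iD ci i; rewrite ltnS leq_eqVlt.
  by case/predU1P=> [->//|/ci].
case: Dv; have sS := spnK_subsp D.
have -> : v = (c (size D))^-1 *: (\sum_(i < size D) c i *: D`_i + c (size D) *: v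
    - \sum_(i < size D) c i *: D`_i).
  by rewrite addrC addKr scalerA mulVf // scale1r.
apply: (subspZ _ sS); apply: (subspB sS); first exact: finrk_spnK.
by apply: (subsp_sum sS) => i _; apply: (subspZ _ sS); apply: mem_spnK; apply: mem_nth.
Qed.

(** The coordinates of the [x i] modulo K form a matrix with more rows than columns; a nonzero row
    of its left kernel is the relation. *)
Lemma spnK_dependent m n (x : 'I_m -> V) (y : 'I_n -> V) : (n < m)%N ->
  (forall i, spnK [seq y j | j : 'I_n] (x i)) ->
  exists2 c : 'I_m -> k, finrk B (\sum_i c i *: x i) & exists i, c i != 0.
Proof.
move=> nm xy; have sK := finrk_subsp tB.
have szy : size [seq y j | j : 'I_n] = n by rewrite size_map size_enum_ord.
have nthy (j : 'I_n) : [seq y j | j : 'I_n]`_j = y j.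
  rewrite (nth_map j) ?size_enum_ord //; congr y; apply: val_inj.
  by rewrite /= nth_enum_ord.
have {xy} /fin_all_exists[a Ka] : forall i, exists a : nat -> k,
    finrk B (x i - \sum_(j < n) a j *: y j).
  move=> i; have [a] := spnK_coord (xy i); rewrite szy => Ka; exists a.
  by under eq_bigr => j _ do rewrite -nthy.
pose M := \matrix_(i < m, j < n) a i j.
have : kermx M != 0.
  rewrite -mxrank_eq0 mxrank_ker -lt0n subn_gt0.
  exact: leq_ltn_trans (rank_leq_col _) nm.
case/matrix0Pn=> r [i nz].
exists (fun i => kermx M r i); last by exists i.
have -> : \sum_i kermx M r i *: x i =
    \sum_i kermx M r i *: (x i - \sum_(j < n) a i j *: y j).
  under [RHS]eq_bigr => l _ do rewrite scalerBr.
  rewrite sumrB [X in _ = _ - X](_ : _ = 0) ?subr0 //.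
  under eq_bigr => l _ do rewrite scaler_sumr.
  rewrite exchange_big big1 //= => j _.
  under eq_bigr => l _ do rewrite scalerA.
  have /matrixP/(_ r j) := mulmx_ker M; rewrite -scaler_suml mxE [RHS]mxE => E.
  rewrite (_ : \sum_i0 _ = 0) ?scale0r // -[RHS]E.
  by apply: eq_bigr => l _; rewrite [M _ _]mxE.
by apply: (subsp_sum sK) => l _; apply: (subspZ _ sK).
Qed.

(** Induction on the cuts. If [l] is nonzero at some [x] of the larger space, the induction
    hypothesis is applied to [x :: D]; moving [w] along [x] into the kernel of [l] then cannot bring
    it into the span. *)
Lemma cosub_not_spnK U : (forall D, exists v, ~ spnK D v) -> cosub U ->
  forall D, exists2 w, U w & ~ spnK D w.
Proof.
move=> infK; elim=> {}U => [UT|U' l cU IH ll U'E] D.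
  by have [v Dv] := infK D; exists v.
have sU := cosub_subsp cU.
case: (classic (exists2 x, U x & l x <> 0)) => [[x Ux /eqP lx]|H]; last first.
  have [w Uw Dw] := IH D; exists w => //; apply/U'E; split=> //.
  by apply: NNPP => lw; apply: H; exists w.
have [w Uw Dw] := IH (x :: D).
have sS := spnK_subsp (x :: D).
exists (w - (l w / l x) *: x).
  apply/U'E; split; first by apply: (subspB sU) => //; apply: (subspZ _ sU).
  by rewrite addrC -scaleNr ll mulNr divfK // addNr.
move=> Dw'; apply: Dw; rewrite -(subrK ((l w / l x) *: x) w).
apply: (subspD sS); last by apply: (subspZ _ sS); apply: mem_spnK; rewrite mem_head.
by apply: spnK_sub Dw' => d; rewrite inE orbC => ->.
Qed.

End ModFinrk.

(** * Solutions outside a given span when V/K is infinite-dimensional *)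

Section SolveInf.
Variables (k : closedFieldType) (V : lmodType k) (B : V -> V -> V -> k).
Hypotheses (tB : trisym B) (n2 : 2%:R != 0 :> k) (n3 : 3%:R != 0 :> k).
Hypothesis nd : forall U, cosub U -> exists2 v, U v & B v v v != 0.
Hypothesis infK : forall D, exists v, ~ spnK B D v.

Lemma primitive_cube_root : exists2 w : k, w ^+ 3 = 1 & w != 1.
Proof.
(* A root of w^2 + w + 1, which differs from 1 because 3 is nonzero. *)
have [w wE] := @solve_monicpoly k 2 (fun=> - 1) isT.
exists w; move: wE; rewrite !big_ord_recl big_ord0 /= /bump /= addn0 expr0 expr1.
  by move=> wE; rewrite exprS wE; ring: wE.
move=> wE; apply/eqP=> w1; case/negP: n3; move: wE; rewrite w1 expr1n => wE.
by apply/eqP; transitivity (1 - (-1 * 1 + (-1 * 1 + 0)) : k); [ring | rewrite -wE subrr].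
Qed.

(* With w outside the span, v correcting q(w) and u correcting f(w), all the
   vectors w +- v + eta u (eta a cube root of unity) are solutions, and they
   cannot all lie in a proper subspace avoiding w. *)
Lemma solve_system_indep os (tau : nat -> k) tf U : cosub U -> indepK B os ->
  exists v, [/\ U v, ~ spnK B os v,
    forall i, (i < size os)%N -> B os`_i v v = tau i & B v v v = tf].
Proof.
move=> cU ios; have sU := cosub_subsp cU.
have [w Uw Dw] := cosub_not_spnK infK cU os.
pose os1 := rcons os w.
(* The last entry 0 asks for B(w, v, v) = 0; with f(v) = 0 this gives w + v and w - v the same cubic
   value as [w]. *)
pose tau1 i := if (i < size os)%N then tau i - B os`_i w w else 0.
have [|v [[Uv ov] qv fv]] := @solve_system _ _ B tB n2 nd os1 tau1 0 _
    (cosubI cU (orth_cosub tB os1)).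
  move=> c /(indepK_rcons ios Dw) c0; rewrite big1 // => i _.
  by rewrite c0 ?mul0r.
have [|u [[Uu ou] qu fu]] := @solve_system _ _ B tB n2 nd (v :: os1) (fun=> 0)
    (tf - B w w w) _ (cosubI cU (orth_cosub tB (v :: os1))).
  by move=> c _; rewrite big1 // => i _; rewrite mulr0.
have wos1 : w \in os1 by rewrite mem_rcons mem_head.
have os1i i : (i < size os)%N -> os`_i \in os1.
  by move=> ii; rewrite mem_rcons inE mem_nth ?orbT.
have os1v d : d \in os1 -> d \in v :: os1 by move=> dd; rewrite inE dd orbT.
have sol (e h : k) : e ^+ 2 = 1 -> h ^+ 3 = 1 ->
   [/\ U (w + e *: v + h *: u),
    forall i, (i < size os)%N -> B os`_i (w + e *: v + h *: u) (w + e *: v + h *: u) = tau i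
     & B (w + e *: v + h *: u) (w + e *: v + h *: u) (w + e *: v + h *: u) = tf].
  move=> e2 h3; split.
  - by apply: (subspD sU); [apply: (subspD sU) => //|]; apply: (subspZ _ sU).
  - move=> i ii; rewrite !quadD //.
    have -> : B os`_i (w + e *: v) u = 0.
      rewrite addrC (tril2 tB _ _ e v w) !ou ?mulr0 ?addr0 ?mem_head //;
        by rewrite inE ?wos1 ?os1i ?orbT.
    have -> : B os`_i u u = 0.
      have := qu i.+1; rewrite /= nth_rcons ii; apply.
      by rewrite ltnS size_rcons ltnS ltnW.
    rewrite (ov os`_i w) ?os1i // e2.
    have := qv i; rewrite nth_rcons ii /tau1 ii size_rcons ltnS ltnW // => -> //; ring.
  rewrite !cubeD // h3 fv fu.
  have -> : B (w + e *: v) u u = 0.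
    rewrite addrC (tril1 tB _ _ e v w).
    have := qu 0%N isT; rewrite /= => ->.
    have := qu (size os).+1; rewrite /= nth_rcons ltnn eqxx => ->; first by ring.
    by rewrite size_rcons.
  have -> : B (w + e *: v) (w + e *: v) u = 0.
    apply: (orth_spn tB ou); apply: (subspD (spn_subsp _));
      try apply: (subspZ _ (spn_subsp _)); apply: mem_spn; by rewrite ?mem_head ?os1v.
  rewrite (ov w w) //.
  have -> : B w v v = 0.
    have := qv (size os); rewrite nth_rcons ltnn eqxx size_rcons ltnS => -> //.
    by rewrite /tau1 ltnn.
  ring.
have [z z3 z1] := primitive_cube_root.
apply: NNPP => H.
have spn_sol (e h : k) : e ^+ 2 = 1 -> h ^+ 3 = 1 -> spnK B os (w + e *: v + h *: u).
  move=> e2 h3; apply: NNPP => Dx; apply: H; have [s1 s2 s3] := sol e h e2 h3.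
  by exists (w + e *: v + h *: u).
have sS := spnK_subsp B os.
have x1 := spn_sol 1 1 (expr1n _ _) (expr1n _ _).
have x2 := spn_sol (-1) 1 (etrans (sqrrN _) (expr1n _ _)) (expr1n _ _).
have x3 := spn_sol 1 z (expr1n _ _) z3.
have Dv : spnK B os v.
  have -> : v = 2%:R^-1 *: ((w + 1 *: v + 1 *: u) - (w + (-1) *: v + 1 *: u)).
    rewrite opprD addrACA subrr addr0 opprD addrACA subrr add0r -scalerBl opprK scalerA.
    by rewrite mulVf // scale1r.
  by apply: (subspZ _ sS); apply: (subspB sS).
have Du : spnK B os u.
  have -> : u = (1 - z)^-1 *: ((w + 1 *: v + 1 *: u) - (w + 1 *: v + z *: u)).
    rewrite opprD addrACA subrr add0r -scalerBl scalerA mulVf ?scale1r //.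
    by rewrite subr_eq0 eq_sym.
  by apply: (subspZ _ sS); apply: (subspB sS).
apply: Dw; have -> : w = (w + 1 *: v + 1 *: u) - u - v by rewrite !scale1r !addrK.
by apply: (subspB sS) => //; apply: (subspB sS).
Qed.

End SolveInf.

(** * Models inside a non-degenerate space *)

Section Sequences.
Variables (k : closedFieldType) (V : lmodType k) (B : V -> V -> V -> k).
Hypothesis tB : trisym B.

(* B vanishes on three vectors of the sequence unless the two latest coincide. *)
Definition staircase (xs : seq V) (e : nat -> V) (T : nat -> nat -> k) (kap : nat -> k) :=
  forall n, [/\ orth B (xs ++ mkseq e n) (e n),
    forall i, (i < size xs + n)%N -> B (xs ++ mkseq e n)`_i (e n) (e n) = T i n
    & B (e n) (e n) (e n) = kap n].

(** The new [e Q] is orthogonal to the span containing the partial sum, so the term linear in its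
    coefficient drops out and only the square and cube terms of [cubeD] are added. *)
Lemma staircase_cube xs e T kap : staircase xs e T kap ->
  forall (s a : nat -> k) Q, let u := \sum_(i < size xs) s i *: xs`_i in
  let x := u + \sum_(n < Q) a n *: e n in
  B x x x = B u u u + \sum_(n < Q) (3%:R * a n ^+ 2 *
    (\sum_(i < size xs) s i * T i n + \sum_(m < n) a m * T (size xs + m)%N n)
    + a n ^+ 3 * kap n).
Proof.
move=> st s a Q u; elim: Q => [|Q IH] /=; first by rewrite !big_ord0 !addr0.
rewrite !big_ord_recr /= addrA cubeD //= IH /=; set x := u + _.
have [oQ TQ ->] := st Q.
have Dx i : (i < size xs)%N -> xs`_i \in xs ++ mkseq e Q.
  by move=> ii; rewrite mem_cat mem_nth.
have De m : (m < Q)%N -> e m \in xs ++ mkseq e Q.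
  by move=> mQ; rewrite mem_cat; apply/orP; right; apply: map_f; rewrite mem_iota.
have Sx : spn (xs ++ mkseq e Q) x.
  have sS := spn_subsp (xs ++ mkseq e Q).
  by apply: (subspD sS); apply: (subsp_sum sS) => i _; apply: (subspZ _ sS);
    apply: mem_spn; [apply: Dx | apply: De].
rewrite (orth_spn tB oQ Sx Sx) /x (lfunD _ _ (tril1 tB _ _)) !(lfun_sum _ _ _ (tril1 tB _ _)).
rewrite mulr0 addr0 -!addrA; congr (_ + (_ + _)); congr (_ * (_ + _) + _).
  apply: eq_bigr => i _; rewrite -TQ ?nth_cat ?ltn_ord //.
  exact: leq_trans (ltn_ord i) (leq_addr _ _).
apply: eq_bigr => i _; rewrite -TQ ?ltn_add2l //.
by rewrite nth_cat ltnNge leq_addr addKn nth_mkseq.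
Qed.

Hypotheses (n2 : 2%:R != 0 :> k) (n3 : 3%:R != 0 :> k).
Hypothesis nd : forall U, cosub U -> exists2 v, U v & B v v v != 0.

(** One staircase carries both families: the [A q] at even positions and the [E q] at odd ones.
    Since [nu q <= q], the vector [A (nu q)] precedes [E q], so its value on the square of [E q] can
    still be prescribed. *)
Lemma model_inf (nu : nat -> nat) : (forall D, exists v, ~ spnK B D v) ->
  (forall q, (nu q <= q)%N) -> exists A E : nat -> V, forall Q (al be : nat -> k),
  let x := \sum_(q < Q) al q *: A q + \sum_(q < Q) be q *: E q in
  B x x x = \sum_(q < Q) 3%:R * al (nu q) * be q ^+ 2.
Proof.
move=> infK nuq; pose T i n : k := (odd n && (i == (nu n./2).*2))%:R.
have [e st] : exists e, staircase [::] e T (fun=> 0).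
  pose P D v := [/\ orth B D v, forall i, (i < size D)%N -> B D`_i v v = T i (size D)
    & B v v v = 0].
  have [||e eP] := @sequence_build V (indepK B) P [::].
  - by move=> c _ i; rewrite ltn0.
  - move=> D iD; have [v [oD Dv qv fv]] := solve_system_indep tB n2 n3 nd infK
      (fun i => T i (size D)) 0 (orth_cosub tB D) iD.
    by exists v; split; [split | apply: indepK_rcons].
  by exists e => n; have [o1 q1 f1] := eP n; rewrite /= size_mkseq in q1 *; split.
exists (fun q => e q.*2), (fun q => e q.*2.+1) => Q al be x.
pose a n := if odd n then be n./2 else al n./2.
have xE : x = \sum_(i < 0) 0 *: [::]`_i + \sum_(n < Q.*2) a n *: e n.
  rewrite big_ord0 add0r /x; elim: (Q) => [|m IH]; first by rewrite !big_ord0 addr0.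
  rewrite doubleS !big_ord_recr /= -IH /a /= odd_double /= doubleK uphalf_double.
  by rewrite -!addrA; congr (_ + _); rewrite addrCA.
rewrite xE (staircase_cube st (fun=> 0) a Q.*2) big_ord0 (lfun0 (tril1 tB _ _)) add0r.
elim: (Q) => [|m IH]; first by rewrite !big_ord0.
rewrite doubleS [LHS]big_ord_recr [X in X + _ = _]big_ord_recr [RHS]big_ord_recr /= {}IH.
rewrite -addrA; congr (_ + _).
rewrite !big_ord0 !mulr0 !add0r !addr0.
rewrite big1 => [|i _]; last by rewrite /T odd_double mulr0.
have lt : ((nu m).*2 < m.*2.+1)%N by rewrite ltnS leq_double.
rewrite mulr0 add0r (bigD1 (Ordinal lt)) //= big1 => [|i].
  rewrite /T /a /= !odd_double /= add0n uphalf_double doubleK eqxx (_ : true%:R = 1 :> k) //; ring.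
by rewrite -val_eqE /T /= ?add0n odd_double uphalf_double /= => /negPf->; rewrite mulr0.
Qed.

(** The [E q] are taken in [U], hence in K, so every relation modulo K among the vectors chosen so
    far has zero coefficients on [xs]. The prescribed values vanish at the earlier [E q], so
    [solve_system] applies. *)
Lemma model_fin (xs : seq V) (U : V -> Prop) (nu : nat -> nat) : indepK B xs ->
  cosub U -> (forall v, U v -> finrk B v) ->
  exists E : nat -> V, forall Q (al be : nat -> k),
  let u := \sum_(i < size xs) al i *: xs`_i in
  let x := u + \sum_(q < Q) be q *: E q in
  B x x x = B u u u + \sum_(q < Q) (if (nu q < size xs)%N
     then 3%:R * al (nu q) * be q ^+ 2 else be q ^+ 3).
Proof.
move=> ixs cU UK; have sK := finrk_subsp tB.
(* If [nu n] indexes a vector of [xs], the square of the new vector pairs with that one alone and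
   its cube is 0; otherwise it pairs with no earlier vector and its cube is 1. *)
pose T i n : k := ((i == nu n) && (i < size xs)%N)%:R.
pose kap n : k := (size xs <= nu n)%N%:R.
have [e st] : exists e, staircase xs e T kap.
  pose P D v := [/\ orth B D v,
    forall i, (i < size D)%N -> B D`_i v v = T i (size D - size xs)%N
    & B v v v = kap (size D - size xs)%N].
  pose Good D := exists2 es, D = xs ++ es & forall d, d \in es -> finrk B d.
  have [||e eP] := @sequence_build V Good P xs.
  - by exists [::]; rewrite ?cats0.
  - move=> _ [es -> esK].
    have [|v [[oD Uv] qv fv]] := @solve_system _ _ B tB n2 nd (xs ++ es)
        (fun i => T i (size (xs ++ es) - size xs)%N)
        (kap (size (xs ++ es) - size xs)%N) _ (cosubI (orth_cosub tB (xs ++ es)) cU).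
      move=> c; rewrite size_cat !big_split_ord /= => Kc.
      rewrite [X in _ + X]big1 => [|i _]; last by rewrite /T ltnNge leq_addr andbF mulr0.
      rewrite addr0 big1 // => i _; rewrite ixs ?mul0r //.
      rewrite [X in finrk B X](_ : _ = \sum_(i < size xs) c i *: (xs ++ es)`_i).
        rewrite -(addrK (\sum_(i < size es) c (size xs + i)%N *: (xs ++ es)`_(size xs + i))
           (\sum_(i < size xs) _)).
        apply: (subspB sK) => //; apply: (subsp_sum sK) => j _; apply: (subspZ _ sK).
        by apply: esK; rewrite nth_cat ltnNge leq_addr addKn mem_nth.
      by apply: eq_bigr => j _; rewrite nth_cat ltn_ord.
    exists v; split=> //; exists (rcons es v); first by rewrite rcons_cat.
    by move=> d; rewrite mem_rcons inE => /predU1P[->|/esK//]; apply: UK.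
  by exists e => n; have [o1 q1 f1] := eP n; rewrite /= size_cat size_mkseq addKn in q1 f1; split.
exists e => Q al be u x.
rewrite (staircase_cube st) -/u; congr (_ + _); apply: eq_bigr => q _.
rewrite [X in _ * (_ + X)]big1 => [|m _]; last by rewrite /T ltnNge leq_addr andbF mulr0.
rewrite addr0 /kap; case: ltnP => nuq.
  rewrite (bigD1 (Ordinal nuq)) //= big1 => [|i].
    by rewrite /T eqxx nuq (_ : true%:R = 1 :> k) //; ring.
  by rewrite -val_eqE /T /= => /negPf->; rewrite mulr0.
rewrite big1 => [|i _]; first by rewrite (_ : true%:R = 1 :> k) //; ring.
by rewrite /T; case: eqP => [->|]; rewrite ?mulr0 //= ltnNge nuq mulr0.
Qed.

End Sequences.

(** * Cubic forms as locally finite sums of powers *)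

Section Decomposition.
Variable k : closedFieldType.
Implicit Types (t b c : nat -> k) (G : nat -> nat -> nat -> k).

Definition ev N b t := \sum_(p < N) b p * t p.

Definition cubic_form N G t :=
  \sum_(i < N) \sum_(j < N) \sum_(l < N) G i j l * t i * t j * t l.

Lemma ev_linear N (x y : k) b c t :
  ev N (fun p => x * b p + y * c p) t = x * ev N b t + y * ev N c t.
Proof. by rewrite /ev !mulr_sumr -big_split; apply: eq_bigr => p _ /=; ring. Qed.

Lemma ev_delta N m t : (m < N)%N -> ev N (fun p => (p == m)%:R) t = t m.
Proof.
move=> mN; rewrite /ev (bigD1 (Ordinal mN)) //= eqxx mul1r big1 ?addr0 // => i.
by rewrite -val_eqE /= => /negPf->; rewrite mul0r.
Qed.

Lemma ev_tail N n b t :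
  ev N (fun p => (n < p)%:R * b p) t = \sum_(n.+1 <= p < N) b p * t p.
Proof.
rewrite /ev big_geq_mkord [RHS]big_mkcond; apply: eq_bigr => p _ /=.
by case: (n < p)%N; rewrite ?mul0r ?mul1r.
Qed.

(** Terms are grouped by their smallest index, which the induction peels off. *)
Lemma quad_form_split (H : nat -> nat -> k) N t n : (forall i j, H i j = H j i) ->
  \sum_(n <= i < N) \sum_(n <= j < N) H i j * t i * t j =
  \sum_(n <= m < N) t m * (H m m * t m + 2%:R * \sum_(m.+1 <= p < N) H m p * t p).
Proof.
move=> Hs; have [nN|/ltnW Nn] := leqP n N; last by rewrite !big_geq.
rewrite -(subKn nN); elim: (N - n)%N (leq_subr n N) => [|d IH] dN.
  by rewrite subn0 !big_geq.
have lt : (N - d.+1 < N)%N by lia.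
have E : (N - d.+1).+1 = (N - d)%N by lia.
rewrite [RHS]big_ltn // E -IH ?(ltnW dN) //.
set a := (N - d.+1)%N; set r := (N - d)%N.
have split1 (F : nat -> k) : \sum_(a <= i < N) F i = F a + \sum_(r <= i < N) F i.
  by rewrite big_ltn // E.
rewrite [LHS]split1 split1.
under [X in _ + X = _]eq_bigr => i _ do rewrite split1.
rewrite big_split /= addrA; congr (_ + _).
have -> : \sum_(r <= i < N) H i a * t i * t a = t a * \sum_(r <= p < N) H a p * t p.
  by rewrite mulr_sumr; apply: eq_bigr => i _; rewrite Hs; ring.
have -> : \sum_(r <= i < N) H a i * t a * t i = t a * \sum_(r <= p < N) H a p * t p.
  by rewrite mulr_sumr; apply: eq_bigr => i _; ring.
ring.
Qed.

(** Again grouped by the smallest index. Each factor 3 counts placements: of the one larger index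
    when [n] occurs twice, of [n] itself when it occurs once. *)
Lemma cubic_form_split G N t : (forall i j l, G i j l = G j i l) ->
  (forall i j l, G i j l = G i l j) ->
  cubic_form N G t = \sum_(0 <= n < N) t n * (t n *
    (G n n n * t n + 3%:R * \sum_(n.+1 <= p < N) G n n p * t p)
    + 3%:R * \sum_(n.+1 <= m < N) \sum_(n.+1 <= p < N) G n m p * t m * t p).
Proof.
move=> G12 G23.
pose S a := \sum_(a <= i < N) \sum_(a <= j < N) \sum_(a <= l < N) G i j l * t i * t j * t l.
have -> : cubic_form N G t = S 0%N.
  rewrite /S big_mkord; apply: eq_bigr => i _; rewrite big_mkord.
  by apply: eq_bigr => j _; rewrite big_mkord.
suff H d : (d <= N)%N -> S (N - d)%N = \sum_(N - d <= n < N) t n * (t n *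
    (G n n n * t n + 3%:R * \sum_(n.+1 <= p < N) G n n p * t p)
    + 3%:R * \sum_(n.+1 <= m < N) \sum_(n.+1 <= p < N) G n m p * t m * t p).
  by have := H N (leqnn N); rewrite subnn.
elim: d => [|d IH] dN; first by rewrite /S subn0 !big_geq.
have lt : (N - d.+1 < N)%N by lia.
have E : (N - d.+1).+1 = (N - d)%N by lia.
rewrite [RHS]big_ltn // E -IH ?(ltnW dN) // /S.
set a := (N - d.+1)%N; set r := (N - d)%N.
have split1 (F : nat -> k) : \sum_(a <= i < N) F i = F a + \sum_(r <= i < N) F i.
  by rewrite big_ltn // E.
have split2 (Y : nat -> nat -> k) : \sum_(a <= i < N) \sum_(a <= j < N) Y i j =
    Y a a + \sum_(r <= j < N) Y a j + \sum_(r <= i < N) Y i a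
    + \sum_(r <= i < N) \sum_(r <= j < N) Y i j.
  rewrite split1 split1; under [X in _ + X = _]eq_bigr => i _ do rewrite split1.
  by rewrite big_split /=; ring.
rewrite [LHS]split1 split2.
under [X in _ + X = _]eq_bigr => i _ do rewrite split2.
rewrite !big_split /=.
have e1 (F : nat -> k) x : (forall l, F l = G a a l * t l * x) ->
    \sum_(r <= l < N) F l = x * \sum_(r <= l < N) G a a l * t l.
  by move=> FE; rewrite mulr_sumr; apply: eq_bigr => l _; rewrite FE mulrC.
have e2 (F : nat -> nat -> k) : (forall j l, F j l = G a j l * t j * t l * t a) ->
    \sum_(r <= j < N) \sum_(r <= l < N) F j l =
    t a * \sum_(r <= j < N) \sum_(r <= l < N) G a j l * t j * t l.
  move=> FE; rewrite mulr_sumr; apply: eq_bigr => j _; rewrite mulr_sumr.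
  by apply: eq_bigr => l _; rewrite FE mulrC.
rewrite (e1 (fun l => _) (t a * t a)) => [|l]; last by ring.
rewrite (e1 (fun j => G a j a * _ * _ * _) (t a * t a)) => [|l]; last by rewrite G23; ring.
rewrite (e1 (fun j => G j a a * _ * _ * _) (t a * t a)) => [|l]; last by rewrite G12 G23; ring.
rewrite (e2 (fun j l => G a j l * _ * _ * _)) => [|j l]; last by ring.
rewrite (e2 (fun j l => G j a l * _ * _ * _)) => [|j l]; last by rewrite G12; ring.
rewrite (e2 (fun j l => G j l a * _ * _ * _)) => [|j l]; last by rewrite G23 G12; ring.
ring.
Qed.

Lemma ev_scale N (x : k) b t : ev N (fun p => x * b p) t = x * ev N b t.
Proof. by rewrite /ev mulr_sumr; apply: eq_bigr => p _; rewrite mulrA. Qed.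

(** The cofactor q_n of t_n becomes a sum of products of linear forms in t_n, t_(n+1), ..., and t_p
    occurs only in products numbered below [M p]. Finite rank makes [M] constant; otherwise
    [quad_form_split] supplies one product per later variable. *)
Lemma quad_products G n (fin : bool) : (forall i j l, G i j l = G i l j) ->
  (fin -> exists d (l l' : nat -> nat -> k), forall m p,
     G n m p = \sum_(j < d) (l j m * l' j p + l' j m * l j p)) ->
  exists (b c : nat -> nat -> k) (M : nat -> nat),
  [/\ forall m p, (p < n)%N || (M p <= m)%N -> b m p = 0 /\ c m p = 0,
      fin -> forall p, M p = M 0%N
    & forall N t L, (n < N)%N -> (forall p, (p < N)%N -> (M p <= L)%N) ->
      t n * (G n n n * t n + 3%:R * \sum_(n.+1 <= p < N) G n n p * t p)
      + 3%:R * \sum_(n.+1 <= m < N) \sum_(n.+1 <= p < N) G n m p * t m * t p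
      = \sum_(m < L) ev N (b m) t * ev N (c m) t].
Proof.
move=> G23 Gfin.
(* The part of q_n divisible by t_n is t_n times this form; it becomes product number 0. *)
pose c0 p := G n n n * (p == n)%:R + 3%:R * ((n < p)%N%:R * G n n p).
have c0E N t : (n < N)%N ->
    ev N c0 t = G n n n * t n + 3%:R * \sum_(n.+1 <= p < N) G n n p * t p.
  by move=> nN; rewrite ev_linear ev_delta // ev_tail.
have c00 p : (p < n)%N -> c0 p = 0.
  by move=> pn; rewrite /c0 (ltn_eqF pn) ltnNge (ltnW pn) /=; ring.
case: fin Gfin => [/(_ isT)[d [l [l' GE]]]|_].
  exists (fun m p => if m is j.+1 then (j < d)%N%:R * ((n < p)%N%:R * l j p) else (p == n)%:R).
  (* Here 6 is the 3 of the splitting times 2, as the two products in [GE] coincide on the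
     diagonal. *)
  exists (fun m p => if m is j.+1 then 6%:R * ((j < d)%N%:R * ((n < p)%N%:R * l' j p)) else c0 p).
  exists (fun=> d.+1); split=> // [[|j] p /orP[pn|]|].
  - by rewrite c00 // (ltn_eqF pn).
  - by rewrite ltn0.
  - by rewrite [(n < p)%N]ltnNge (ltnW pn) /= !mul0r !mulr0.
  - by rewrite ltnS ltnNge => -> /=; rewrite !mul0r !mulr0.
  move=> N t [|L] nN HL; first by have := HL n nN.
  have {}HL : (d <= L)%N by have := HL n nN; rewrite ltnS.
  rewrite big_ord_recl /= ev_delta // c0E //; congr (_ + _).
  pose a j := \sum_(n.+1 <= p < N) l j p * t p.
  pose a' j := \sum_(n.+1 <= p < N) l' j p * t p.
  transitivity (\sum_(j < d) 6%:R * (a j * a' j)).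
    transitivity (3%:R * \sum_(j < d) (a j * a' j + a' j * a j)).
      congr (_ * _); transitivity (\sum_(n.+1 <= m < N) \sum_(n.+1 <= p < N)
          \sum_(j < d) (l j m * l' j p + l' j m * l j p) * t m * t p).
        by apply: eq_bigr => m _; apply: eq_bigr => p _; rewrite GE !mulr_suml.
      under eq_bigr => m _ do rewrite exchange_big.
      rewrite exchange_big; apply: eq_bigr => j _ /=.
      rewrite /a /a' !big_distrlr -big_split; apply: eq_bigr => m _ /=.
      by rewrite -big_split; apply: eq_bigr => p _ /=; ring.
    by rewrite mulr_sumr; apply: eq_bigr => j _; ring.
  rewrite (big_ord_widen L (fun j => 6%:R * (a j * a' j)) HL) big_mkcond.
  apply: eq_bigr => j _; rewrite !ev_scale !ev_tail !add0n -/(a j) -/(a' j).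
  by case: (j < d)%N; rewrite /= ?mulr1n ?mulr0n; ring.
exists (fun m p => if m is i.+1 then (n < i)%N%:R * (p == i)%:R else (p == n)%:R).
exists (fun m p => if m is i.+1 then (3%:R * (n < i)%N%:R) *
  (G n i i * (p == i)%:R + 2%:R * ((i < p)%N%:R * G n i p)) else c0 p).
(* Product number i + 1 involves only variables t_p with p >= i; counting number 0, t_p occurs only
   in numbers below p + 2. *)
exists (fun p => p.+2); split=> // [[|i] p /orP[pn|]|].
- by rewrite c00 // (ltn_eqF pn).
- by rewrite ltn0.
- case: (ltnP n i) => [ni|_]; last by rewrite /= !mulr0 !mul0r.
  rewrite (ltn_eqF (ltn_trans pn ni)) [(i < p)%N]ltnNge.
  by rewrite (ltnW (ltn_trans pn ni)) /= !(mul0r,mulr0,addr0).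
- by rewrite ltnS => pi; rewrite (ltn_eqF pi) [(i < p)%N]ltnNge (ltnW pi) /= !(mul0r,mulr0,addr0).
move=> N t [|L] nN HL; first by have := HL n nN.
have {}HL : (N <= L)%N.
  by case: N nN HL => // N _ /(_ N (ltnSn N)); rewrite ltnS.
rewrite big_ord_recl /= ev_delta // c0E //; congr (_ + _).
rewrite (quad_form_split N t n.+1 (G23 n)) mulr_sumr big_geq_mkord.
rewrite (big_ord_widen_cond L (fun m => (n < m)%N) (fun m => 3%:R * (t m *
   (G n m m * t m + 2%:R * (\sum_(m.+1 <= p < N) G n m p * t p)))) HL) big_mkcond.
apply: eq_bigr => m _; rewrite !ev_scale ev_linear ev_tail !add0n.
have [mN|Nm] := ltnP m N; last first.
  rewrite andbF (_ : ev N _ t = 0) ?mulr0 ?mul0r // /ev big1 // => p _.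
  by rewrite (ltn_eqF (leq_trans (ltn_ord p) Nm)) mul0r.
by rewrite andbT ev_delta //; case: (n < m)%N; rewrite /= ?mulr1n ?mulr0n; ring.
Qed.
(** Allows powers labelled by triples to be enumerated by a single natural number. *)
Lemma sum_codes (F : nat -> k) N M Q :
  (forall n m e, (n < N)%N -> (m < M)%N -> (e < 4)%N ->
     (CodeSeq.code [:: n; m; e] < Q)%N) ->
  (forall q, F q != 0 -> exists n m e,
     [/\ (n < N)%N, (m < M)%N, (e < 4)%N & q = CodeSeq.code [:: n; m; e]]) ->
  \sum_(q < Q) F q =
  \sum_(n < N) \sum_(m < M) \sum_(e < 4) F (CodeSeq.code [:: val n; val m; val e]).
Proof.
move=> ltQ Fnz.
pose cod (x : 'I_N * 'I_M * 'I_4) := CodeSeq.code [:: val x.1.1; val x.1.2; val x.2].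
have cod_inj : injective cod.
  move=> [[n m] e] [[n' m'] e'] /(can_inj CodeSeq.codeK)[/val_inj-> /val_inj-> /val_inj->].
  by [].
rewrite pair_bigA pair_bigA /=.
transitivity (\sum_(q <- [seq cod x | x : ('I_N * 'I_M * 'I_4)%type]) F q); last first.
  by rewrite big_map big_enum.
rewrite -(big_mkord xpredT) /index_iota subn0.
rewrite (bigID (mem [seq cod x | x : ('I_N * 'I_M * 'I_4)%type])) /=.
rewrite [X in _ + X]big1 ?addr0 => [|q /negP qc]; last first.
  apply/eqP/negP=> /negP/Fnz[n [m [e [nN mM e4 qE]]]]; apply: qc.
  by apply/mapP; exists (Ordinal nN, Ordinal mM, Ordinal e4); rewrite ?mem_enum.
rewrite -big_filter; apply: perm_big; apply: uniq_perm.
- by rewrite filter_uniq // iota_uniq.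
- by rewrite map_inj_uniq // enum_uniq.
move=> q; rewrite mem_filter andb_idr // => /mapP[[[n m] e] _ ->].
by rewrite mem_iota leq0n add0n; apply: ltQ; exact: ltn_ord.
Qed.

Hypotheses (n2 : 2%:R != 0 :> k) (n3 : 3%:R != 0 :> k).

(** The number [q] encodes [n; m; e]: the variable t_n, a product b c in q_n, and one of at most
    four powers. Squares come from 12 t b c = 3 t (b + c)^2 - 3 t (b - c)^2; cubes from 24 t b c,
    the sum of the cubes of t + b + c, t - b - c, b - t - c and c - t - b. A given t_p occurs only
    if n <= p, m < M n p and e < 4, hence in finitely many powers. *)
Lemma cubic_form_powers (al : pred nat) G : (forall i j l, G i j l = G j i l) ->
  (forall i j l, G i j l = G i l j) ->
  (forall n, ~~ al n -> exists d (l l' : nat -> nat -> k), forall m p,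
     G n m p = \sum_(j < d) (l j m * l' j p + l' j m * l j p)) ->
  exists (nu : nat -> nat) (be : nat -> nat -> k),
  [/\ forall q, (nu q <= q)%N,
      forall p, exists Q, forall q, (Q <= q)%N -> be q p = 0
    & forall N, exists Q0, forall Q, (Q0 <= Q)%N -> forall t,
      (forall p, (N <= p)%N -> t p = 0) ->
      cubic_form N G t = \sum_(q < Q) (if al (nu q)
        then 3%:R * t (nu q) * ev N (be q) t ^+ 2 else ev N (be q) t ^+ 3)].
Proof.
move=> G12 G23 Gfin.
have HQ n := quad_products G23 (Gfin n).
have {HQ} HQ n : {x : (nat -> nat -> k) * (nat -> nat -> k) * (nat -> nat) |
  [/\ forall m p, (p < n)%N || (x.2 p <= m)%N -> x.1.1 m p = 0 /\ x.1.2 m p = 0,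
      ~~ al n -> forall p, x.2 p = x.2 0%N
    & forall N t L, (n < N)%N -> (forall p, (p < N)%N -> (x.2 p <= L)%N) ->
      t n * (G n n n * t n + 3%:R * \sum_(n.+1 <= p < N) G n n p * t p)
      + 3%:R * \sum_(n.+1 <= m < N) \sum_(n.+1 <= p < N) G n m p * t m * t p
      = \sum_(m < L) ev N (x.1.1 m) t * ev N (x.1.2 m) t] }.
  apply: constructive_indefinite_description.
  by have [b [c [M HM]]] := HQ n; exists (b, c, M).
pose b n := (sval (HQ n)).1.1; pose c n := (sval (HQ n)).1.2; pose M n := (sval (HQ n)).2.
have supp n m p : (p < n)%N || (M n p <= m)%N -> b n m p = 0 /\ c n m p = 0.
  by case: (svalP (HQ n)) => H _ _; apply: H.
have Mfin n : ~~ al n -> forall p, M n p = M n 0%N by case: (svalP (HQ n)) => _ H _; apply: H.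
have prodE n : forall N t L, (n < N)%N -> (forall p, (p < N)%N -> (M n p <= L)%N) ->
      t n * (G n n n * t n + 3%:R * \sum_(n.+1 <= p < N) G n n p * t p)
      + 3%:R * \sum_(n.+1 <= m < N) \sum_(n.+1 <= p < N) G n m p * t m * t p
      = \sum_(m < L) ev N (b n m) t * ev N (c n m) t.
  by case: (svalP (HQ n)) => _ _ H; apply: H.
clearbody b c M => {HQ Gfin}.
(* These scalings absorb 1/12, -1/12 and 1/24 into the squares and the cubes. *)
have [r1 r1E] := closed_root 1 (12%:R^-1 : k).
have [r2 r2E] := closed_root 1 (- 12%:R^-1 : k).
have [r3 r3E] := closed_root 2 (24%:R^-1 : k).
have n12 : 12%:R != 0 :> k by rewrite (_ : 12 = 2 * 2 * 3)%N // !natrM !mulf_neq0.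
have n24 : 24%:R != 0 :> k by rewrite (_ : 24 = 2 * 12)%N // natrM mulf_neq0.
(* The cubes contain t_n itself, so it must be cut off to keep them locally finite. When [~~ al n],
   all products from number [M n 0] on vanish, so nothing is lost. *)
pose a n m p : k := ((m < M n 0%N)%N && (p == n))%:R.
pose be3 n m e : nat -> k := if al n then
    match e with 0 => fun p => r1 * b n m p + r1 * c n m p
    | 1 => fun p => r2 * b n m p + (- r2) * c n m p | _ => fun p => 0 end
  else match e with
    | 0 => fun p => r3 * a n m p + 1 * (r3 * b n m p + r3 * c n m p)
    | 1 => fun p => (- r3) * a n m p + 1 * ((- r3) * b n m p + r3 * c n m p)
    | 2 => fun p => (- r3) * a n m p + 1 * (r3 * b n m p + (- r3) * c n m p)
    | 3 => fun p => r3 * a n m p + 1 * ((- r3) * b n m p + (- r3) * c n m p)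
    | _ => fun p => 0 end.
have be3_0 n m e p : (p < n)%N || (M n p <= m)%N || (4 <= e)%N -> be3 n m e p = 0.
  rewrite orbC; case/orP=> [|nm].
    by rewrite /be3; case: e => [|[|[|[|e]]]] // _; case: ifP.
  have [b0 c0] := supp _ _ _ nm; rewrite /be3; case: ifP => al_n.
    by case: e => [|[|e]] //; rewrite b0 c0; ring.
  have a0 : a n m p = 0.
    rewrite /a; case: eqP => [pn|]; last by rewrite andbF.
    by move: nm; rewrite pn ltnn /= Mfin ?al_n // ltnNge => ->.
  by case: e => [|[|[|[|e]]]] //; rewrite a0 b0 c0; ring.
pose nu q := head 0%N (CodeSeq.decode q).
pose be q := match CodeSeq.decode q with [:: n; m; e] => be3 n m e | _ => fun=> 0 end.
have beE n m e : be (CodeSeq.code [:: n; m; e]) = be3 n m e by rewrite /be CodeSeq.codeK.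
have nuE n m e : nu (CodeSeq.code [:: n; m; e]) = n by rewrite /nu CodeSeq.codeK.
have be0 q p : be q p != 0 -> exists n m e, [/\ (n <= p)%N, (m < M n p)%N, (e < 4)%N
     & q = CodeSeq.code [:: n; m; e]].
  rewrite /be -{2}[q]CodeSeq.decodeK.
  case: (CodeSeq.decode q) => [|n [|m [|e [|x s]]]] //; rewrite ?eqxx // => nz.
  have : ~~ ((p < n)%N || (M n p <= m)%N || (4 <= e)%N).
    by apply: contra nz => H; apply/eqP; apply: be3_0.
  by rewrite !negb_or -leqNgt -!ltnNge => /andP[/andP[np mM] e4]; exists n, m, e.
(* A sum of naturals dominates each term, so this exceeds every code in the box. *)
pose bnd N L := (\sum_(n < N) \sum_(m < L) \sum_(e < 4) CodeSeq.code [:: val n; val m; val e]).+1.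
have ltbnd N L n m e : (n < N)%N -> (m < L)%N -> (e < 4)%N ->
    (CodeSeq.code [:: n; m; e] < bnd N L)%N.
  move=> nN mL e4; rewrite /bnd ltnS (bigD1 (Ordinal nN)) //= (bigD1 (Ordinal mL)) //=.
  by rewrite (bigD1 (Ordinal e4)) //= -!addnA leq_addr.
pose Mx N := (\sum_(n < N) \sum_(p < N) M n p)%N.
have leMx N n p : (n < N)%N -> (p < N)%N -> (M n p <= Mx N)%N.
  move=> nN pN; rewrite /Mx (bigD1 (Ordinal nN)) //= (bigD1 (Ordinal pN)) //=.
  by rewrite -!addnA leq_addr.
exists nu, be; split.
- move=> q; rewrite /nu; have := CodeSeq.gtn_decode q.
  by case: (CodeSeq.decode q) => //= n s /andP[/ltnW].
- move=> p; exists (bnd p.+1 (Mx p.+1)) => q Qq; apply/eqP/negP=> /negP/be0.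
  case=> n [m [e [np mM e4 qE]]]; move: Qq; rewrite qE leqNgt ltbnd //.
  by apply: leq_trans mM (leMx _ _ _ _ _).
move=> N; exists (bnd N (Mx N)) => Q Q0 t tN.
have ev0 q : ev N (be q) t != 0 -> exists n m e,
    [/\ (n < N)%N, (m < Mx N)%N, (e < 4)%N & q = CodeSeq.code [:: n; m; e]].
  case: (classic (exists2 p, (p < N)%N & be q p != 0)) => [[p pN /be0]|H].
    case=> n [m [e [np mM e4 ->]]] _; exists n, m, e; split=> //.
      exact: leq_ltn_trans pN.
    by apply: leq_trans mM (leMx _ _ _ _ _) => //; apply: leq_ltn_trans pN.
  rewrite /ev big1 ?eqxx // => p _; have [->|nz] := eqVneq (be q p) 0.
    by rewrite mul0r.
  by case: H; exists p.
rewrite (@sum_codes (fun q => if al (nu q) then 3%:R * t (nu q) * ev N (be q) t ^+ 2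
    else ev N (be q) t ^+ 3) N (Mx N)); first last.
- move=> q nz; apply: ev0; apply: contra nz => /eqP->.
  by case: ifP; rewrite expr0n ?mulr0.
- by move=> n m e nN mM e4; apply: leq_trans Q0; apply: ltbnd.
rewrite cubic_form_split // big_mkord; apply: eq_bigr => n _.
rewrite (prodE n N t (Mx N)) //; last by move=> p pN; apply: leMx.
rewrite mulr_sumr; apply: eq_bigr => m _.
rewrite !big_ord_recl big_ord0 /= /bump /= !add1n ?add0n !nuE !beE /be3 /=.
move: (nat_of_ord n) (ltn_ord n) => {}n nN.
case: ifP => al_n; rewrite ?al_n.
  have -> : ev N (fun=> 0) t = 0 by rewrite /ev big1 // => p _; rewrite mul0r.
  rewrite !ev_linear.
  transitivity (3%:R * t n * (r1 ^+ 2 * (ev N (b n m) t + ev N (c n m) t) ^+ 2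
     + r2 ^+ 2 * (ev N (b n m) t - ev N (c n m) t) ^+ 2)); last by ring.
  by rewrite r1E r2E; field; rewrite n12.
rewrite !ev_linear.
have [mM|Mm] := ltnP m (M n 0%N); last first.
  have bc0 p : b n m p = 0 /\ c n m p = 0 by apply: supp; rewrite Mfin ?al_n ?Mm ?orbT.
  have -> : ev N (b n m) t = 0 by rewrite /ev big1 // => p _; rewrite (bc0 p).1 mul0r.
  have -> : ev N (c n m) t = 0 by rewrite /ev big1 // => p _; rewrite (bc0 p).2 mul0r.
  have -> : ev N (a n m) t = 0.
    by rewrite /ev big1 // => p _; rewrite /a ltnNge Mm mul0r.
  ring.
have -> : ev N (a n m) t = t n.
  by rewrite -[RHS](ev_delta _ nN); apply: eq_bigr => p _; rewrite /a mM.
set x := ev N (b n m) t; set y := ev N (c n m) t.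
transitivity (r3 ^+ 3 * (24%:R * (t n * x * y))); last by ring.
by rewrite r3E mulKf // mulrA.
Qed.

End Decomposition.

(** * Realizing prescribed symmetric coefficients by vectors of V *)

Section Realization.
Variables (k : closedFieldType) (V : lmodType k) (B : V -> V -> V -> k).
Hypotheses (tB : trisym B) (n2 : 2%:R != 0 :> k) (n3 : 3%:R != 0 :> k).

Lemma tri_sum N (x : nat -> V) (a b c : nat -> k) :
  B (\sum_(i < N) a i *: x i) (\sum_(i < N) b i *: x i) (\sum_(i < N) c i *: x i) =
  \sum_(i < N) \sum_(j < N) \sum_(l < N) B (x i) (x j) (x l) * a i * b j * c l.
Proof.
rewrite (lfun_sum _ _ _ (tril1 tB _ _)); apply: eq_bigr => i _.
rewrite (lfun_sum _ _ _ (tril2 tB _ _)) mulr_sumr; apply: eq_bigr => j _.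
rewrite (lfun_sum _ _ _ (tril3 tB _ _)) !mulr_sumr; apply: eq_bigr => l _; ring.
Qed.

Lemma cubic_form_widen (G : nat -> nat -> nat -> k) N Q t : (N <= Q)%N ->
  (forall p, (N <= p)%N -> t p = 0) -> cubic_form Q G t = cubic_form N G t.
Proof.
move=> NQ t0.
have w (F : nat -> k) : (forall p, (N <= p)%N -> F p = 0) ->
    \sum_(p < Q) F p = \sum_(p < N) F p.
  move=> F0; rewrite (big_ord_widen Q F NQ) [RHS]big_mkcond; apply: eq_bigr => i _.
  by case: ltnP => // /F0.
rewrite /cubic_form (w (fun i => \sum_(j < Q) \sum_(l < Q) G i j l * t i * t j * t l)).
  apply: eq_bigr => i _; rewrite (w (fun j => \sum_(l < Q) G i j l * t i * t j * t l)).
    apply: eq_bigr => j _; apply: (w (fun l => G i j l * t i * t j * t l)) => l Nl.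
    by rewrite (t0 l) // mulr0.
  by move=> j Nj; rewrite big1 // => l _; rewrite (t0 j) // mulr0 mul0r.
move=> i Ni; rewrite big1 // => j _; rewrite big1 // => l _.
by rewrite (t0 i) // mulr0 !mul0r.
Qed.

Definition sym3 (G : nat -> nat -> nat -> k) :=
  (forall i j l, G i j l = G j i l) /\ (forall i j l, G i j l = G i l j).

Lemma coef_trisym N (G : nat -> nat -> nat -> k) : sym3 G ->
  trisym (fun x y z : 'rV[k]_N =>
    \sum_(i < N) \sum_(j < N) \sum_(l < N) G i j l * x 0 i * y 0 j * z 0 l).
Proof.
move=> [G12 G23]; split=> [y z a u v|u v w|u v w].
- rewrite mulr_sumr -big_split; apply: eq_bigr => i _ /=.
  rewrite mulr_sumr -big_split; apply: eq_bigr => j _ /=.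
  by rewrite mulr_sumr -big_split; apply: eq_bigr => l _ /=; rewrite !mxE; ring.
- rewrite exchange_big; apply: eq_bigr => i _; apply: eq_bigr => j _.
  by apply: eq_bigr => l _; rewrite G12; ring.
apply: eq_bigr => i _; rewrite exchange_big; apply: eq_bigr => j _.
by apply: eq_bigr => l _; rewrite G23; ring.
Qed.

(** Both sides are symmetric trilinear in coefficient rows, so polarization passes from the diagonal
    to all arguments, and unit rows read off the coefficients. *)
Lemma realize_diag N (v : nat -> V) (G : nat -> nat -> nat -> k) : sym3 G ->
  (forall t : nat -> k, (forall p, (N <= p)%N -> t p = 0) ->
    let x := \sum_(p < N) t p *: v p in B x x x = cubic_form N G t) ->
  forall i j l, (i < N)%N -> (j < N)%N -> (l < N)%N -> B (v i) (v j) (v l) = G i j l.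
Proof.
move=> sG diag i j l iN jN lN.
have n6 : 6%:R != 0 :> k by rewrite (_ : 6 = 2 * 3)%N // natrM mulf_neq0.
pose B1 (x y z : 'rV[k]_N) := \sum_(i < N) \sum_(j < N) \sum_(l < N)
  B (v i) (v j) (v l) * x 0 i * y 0 j * z 0 l.
have tB1 : trisym B1.
  by apply: (@coef_trisym N (fun i j l => B (v i) (v j) (v l))); split=> *;
    [apply: triC12 | apply: triC23].
have eqB : forall x y z, B1 x y z =
    \sum_(i < N) \sum_(j < N) \sum_(l < N) G i j l * x 0 i * y 0 j * z 0 l.
  apply: (tri_eq tB1 (coef_trisym N sG) n6) => x.
  pose t p := if insub p is Some p' then x 0 p' else 0.
  have tE (p : 'I_N) : x 0 p = t p by rewrite /t valK.
  have tN p : (N <= p)%N -> t p = 0 by move=> Np; rewrite /t insubF // ltnNge Np.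
  have subst (H : nat -> nat -> nat -> k) :
      \sum_(a < N) \sum_(b < N) \sum_(c < N) H a b c * x 0 a * x 0 b * x 0 c =
      cubic_form N H t.
    by apply: eq_bigr => a _; apply: eq_bigr => b _; apply: eq_bigr => c _; rewrite !tE.
  by rewrite /B1 (subst (fun a b c => B (v a) (v b) (v c))) subst -diag //= tri_sum.
pose d (p : nat) : 'rV[k]_N := \row_q (val q == p)%:R.
have pick (H : nat -> nat -> nat -> k) : \sum_(a < N) \sum_(b < N) \sum_(c < N)
    H a b c * d i 0 a * d j 0 b * d l 0 c = H i j l.
  have one (F : nat -> k) p : (p < N)%N -> \sum_(a < N) F a * d p 0 a = F p.
    move=> pN; rewrite (bigD1 (Ordinal pN)) //= mxE eqxx mulr1 big1 ?addr0 // => a.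
    by rewrite -val_eqE /= mxE => /negPf->; rewrite mulr0.
  transitivity (\sum_(a < N) H a j l * d i 0 a); last exact: (one (fun a => H a j l)).
  apply: eq_bigr => a _.
  transitivity (\sum_(b < N) H a b l * d i 0 a * d j 0 b).
    by apply: eq_bigr => b _; rewrite (one (fun c => H a b c * d i 0 a * d j 0 b)).
  exact: (one (fun b => H a b l * d i 0 a)).
by have := eqB (d i) (d j) (d l); rewrite /B1 (pick (fun a b c => B (v a) (v b) (v c))) pick.
Qed.

(** [F] is the form already carried by the [A q], so the difference G - F is decomposed into powers,
    and v_p adds to [A p] the coefficients of t_p in these powers. Since [F] vanishes when
    [~~ al n], the difference keeps the finite-rank slices of [G]. *)
Lemma realize_form (al : pred nat) (F G : nat -> nat -> nat -> k) :
  sym3 F -> (forall n m p, ~~ al n -> F n m p = 0) ->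
  (forall nu : nat -> nat, (forall q, (nu q <= q)%N) -> exists A E : nat -> V,
     forall Q (a be : nat -> k),
     let x := \sum_(q < Q) a q *: A q + \sum_(q < Q) be q *: E q in
     B x x x = cubic_form Q F a + \sum_(q < Q) (if al (nu q)
       then 3%:R * a (nu q) * be q ^+ 2 else be q ^+ 3)) ->
  sym3 G ->
  (forall n, ~~ al n -> exists d (l l' : nat -> nat -> k), forall m p,
     G n m p = \sum_(j < d) (l j m * l' j p + l' j m * l j p)) ->
  exists v : nat -> V, forall i j l, B (v i) (v j) (v l) = G i j l.
Proof.
move=> [F12 F23] F0 model sG Gfin.
have GFfin n : ~~ al n -> exists d (l l' : nat -> nat -> k), forall m p,
    G n m p - F n m p = \sum_(j < d) (l j m * l' j p + l' j m * l j p).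
  move=> al_n; have [d [l [l' E]]] := Gfin n al_n; exists d, l, l' => m p.
  by rewrite F0 // subr0.
have [nu [be [nuq be0 GE]]] := cubic_form_powers n2 n3
  (fun i j l => congr2 (fun x y => x - y) (sG.1 i j l) (F12 i j l))
  (fun i j l => congr2 (fun x y => x - y) (sG.2 i j l) (F23 i j l)) GFfin.
have [A [E AE]] := model nu nuq.
pose Qf p := sval (constructive_indefinite_description _ (be0 p)).
have QfE p q : (Qf p <= q)%N -> be q p = 0.
  by move=> pq; apply: (svalP (constructive_indefinite_description _ (be0 p))).
pose v p := A p + \sum_(q < Qf p) be q p *: E q.
exists v => i j l; apply: (@realize_diag (i + j + l).+1 v G) => //; try lia.
set N := (i + j + l).+1 => t tN x.
have [Q0 HQ0] := GE N.
(* Large enough for the decomposition, for the N variables and for every sum defining [v p]. *)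
pose Q := (Q0 + N + \sum_(p < N) Qf p)%N.
have xE : x = \sum_(q < Q) t q *: A q + \sum_(q < Q) ev N (be q) t *: E q.
  rewrite /x; under eq_bigr => p _ do rewrite scalerDr.
  rewrite big_split /=; congr (_ + _).
    rewrite (big_ord_widen Q (fun p => t p *: A p)); last by rewrite /Q; lia.
    rewrite big_mkcond; apply: eq_bigr => p _; case: ltnP => // /tN->.
    by rewrite scale0r.
  transitivity (\sum_(p < N) \sum_(q < Q) (be q p * t p) *: E q); last first.
    by rewrite exchange_big; apply: eq_bigr => q _; rewrite -scaler_suml.
  apply: eq_bigr => p _; rewrite scaler_sumr.
  have pQ : (Qf p <= Q)%N by rewrite /Q (bigD1 p) //=; lia.
  rewrite (big_ord_widen Q (fun q => t p *: (be q p *: E q)) pQ) big_mkcond.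
  apply: eq_bigr => q _; rewrite scalerA mulrC; case: ltnP => // /QfE->.
  by rewrite mul0r scale0r.
rewrite xE (AE Q t (fun q => ev N (be q) t)) (cubic_form_widen _ _ tN); last by rewrite /Q; lia.
rewrite -HQ0 //; last by rewrite /Q; lia.
rewrite /cubic_form -big_split; apply: eq_bigr => a _ /=.
rewrite -big_split; apply: eq_bigr => b _ /=.
by rewrite -big_split; apply: eq_bigr => c _ /=; ring.
Qed.

Hypothesis nd : forall U, cosub U -> exists2 v, U v & B v v v != 0.

Lemma realize_inf G : (forall D, exists v, ~ spnK B D v) -> sym3 G ->
  exists v : nat -> V, forall i j l, B (v i) (v j) (v l) = G i j l.
Proof.
move=> infK sG; apply: (@realize_form predT (fun _ _ _ => 0)) => //= nu nuq.
have [A [E AE]] := model_inf tB n2 n3 nd infK nuq; exists A, E => Q a be.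
rewrite AE /cubic_form [X in _ = X + _]big1 ?add0r // => i _; rewrite big1 // => j _.
by rewrite big1 // => l _; rewrite !mul0r.
Qed.

Lemma realize_fin (xs : seq V) (U : V -> Prop) G : indepK B xs ->
  cosub U -> (forall v, U v -> finrk B v) -> sym3 G ->
  (forall n, (size xs <= n)%N -> exists d (l l' : nat -> nat -> k), forall m p,
     G n m p = \sum_(j < d) (l j m * l' j p + l' j m * l j p)) ->
  exists v : nat -> V, forall i j l, B (v i) (v j) (v l) = G i j l.
Proof.
move=> ixs cU UK sG Gfin.
apply: (@realize_form (fun n => (n < size xs)%N)
  (fun i j l => B xs`_i xs`_j xs`_l)) => //=.
- by split=> *; [apply: triC12 | apply: triC23].
- by move=> n m p; rewrite -leqNgt => ?; rewrite nth_default // (lfun0 (tril1 tB _ _)).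
- move=> nu nuq; have [E HE] := model_fin tB n2 nd nu ixs cU UK.
  (* Beyond [size xs] the default value of [nth] is 0, so the remaining [A q] are zero. *)
  exists (fun q => xs`_q), E => Q a be.
  (* [model_fin] sums over all of [xs], here only q < Q occurs. The cut is invisible in the power
     terms, where nu q <= q < Q. *)
  pose a' q := if (q < Q)%N then a q else 0.
  rewrite /= -[cubic_form _ _ _](tri_sum Q (fun q => xs`_q) a a a) /=.
  have -> : \sum_(q < Q) a q *: xs`_q = \sum_(i < size xs) a' i *: xs`_i.
    transitivity (\sum_(i < maxn Q (size xs)) a' i *: xs`_i).
      rewrite (big_ord_widen _ (fun q => a q *: xs`_q) (leq_maxl Q (size xs))) big_mkcond.
      by apply: eq_bigr => i _; rewrite /a'; case: ifP; rewrite ?scale0r.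
    rewrite (big_ord_widen _ (fun q => a' q *: xs`_q) (leq_maxr Q (size xs))) [RHS]big_mkcond.
    by apply: eq_bigr => i _; case: ltnP => // ?; rewrite nth_default // scaler0.
  rewrite HE; congr (_ + _).
  apply: eq_bigr => q _; by rewrite /a' (leq_ltn_trans (nuq q) (ltn_ord q)).
by move=> n; rewrite -leqNgt; apply: Gfin.
Qed.
End Realization.

(** * Formal polynomials and multilinear forms *)

Local Open Scope fset_scope.
Local Open Scope ring_scope.

(** * Forms vanishing on a subspace of finite codimension are finite sums of products *)

Section FiniteRank.
Variables (k : fieldType) (V : lmodType k).
Hypotheses (n2 : 2%:R != 0 :> k) (n3 : 3%:R != 0 :> k).

Lemma lfun_comb (l l' : V -> k) x y : lfun l -> lfun l' ->
  lfun (fun v => x * l v + y * l' v).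
Proof. by move=> ll ll' a u v; rewrite ll ll'; ring. Qed.

(* Cutting U by one more functional l with l v0 = 1 amounts to replacing Q by its
   pullback along the projection v - l(v) v0, which changes Q by one product. *)
Lemma finite_rank_quad (Q : V -> V -> k) U : cosub U -> (forall v, lfun (Q^~ v)) ->
  (forall u v, Q u v = Q v u) -> (forall v, U v -> Q v v = 0) ->
  exists d (l l' : nat -> V -> k),
    [/\ forall j, lfun (l j), forall j, lfun (l' j) &
    forall u v, Q u v = \sum_(j < d) (l j u * l' j v + l' j u * l j v)].
Proof.
move=> cU; elim: cU Q => {}U => [UT|U' l cU IH ll U'E] Q Q1 Qs Q0.
  exists 0%N, (fun _ _ => 0), (fun _ _ => 0); split=> [j a u v|j a u v|u v].
  - by rewrite mulr0 addr0.
  - by rewrite mulr0 addr0.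
  rewrite big_ord0; apply: (mulfI n2); have := Q0 (u + v) (UT _).
  rewrite (lfunD _ _ (Q1 _)) !(Qs _ (u + v)) !(lfunD _ _ (Q1 _)) (Qs v u) !Q0 // => E.
  by rewrite mulr0 -[RHS]E; ring.
case: (classic (exists2 x, U x & l x <> 0)) => [[x Ux /eqP lx]|H]; last first.
  apply: IH => // v Uv; apply: Q0; apply/U'E; split=> //.
  by apply: NNPP => lv; apply: H; exists v.
have sU := cosub_subsp cU.
pose v0 := (l x)^-1 *: x.
have lv0 : l v0 = 1 by rewrite lfunZ // mulVf.
have Uv0 : U v0 by apply: (subspZ _ sU).
pose Q' u v := Q u v - l u * Q v0 v - l v * Q v0 u + l u * l v * Q v0 v0.
have [||| d [m [m' [lm lm' Q'E]]]] := IH Q'.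
- by move=> v a u w; rewrite /Q' ll (Q1 v) !(Qs v0) (Q1 v0); ring.
- by move=> u v; rewrite /Q' (Qs u v); ring.
- move=> v Uv; have -> : Q' v v = Q (- l v *: v0 + v) (- l v *: v0 + v).
    by rewrite (Q1 _) !(Qs _ (_ + _)) !(Q1 _) (Qs v v0) /Q'; ring.
  apply: Q0; apply/U'E; split; first exact: sU.2.
  by rewrite ll lv0 mulr1 addNr.
pose h v := 1 * Q v0 v + (- (2%:R^-1 * Q v0 v0)) * l v.
have lh : lfun h by apply: lfun_comb => // a u v; rewrite !(Qs v0) Q1.
exists d.+1, (fun j => if j is i.+1 then m i else l),
  (fun j => if j is i.+1 then m' i else h); split=> [[|j]|[|j]|u v] //.
rewrite big_ord_recl /=; under eq_bigr => i _ do rewrite add0n.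
by rewrite -Q'E /Q' /h; field.
Qed.

(** As for quadratic forms: the pullback along v - l(v) v0 differs from [T] by the symmetrization of
    [l] times a symmetric bilinear form. *)
Lemma finite_rank_cubic (T : V -> V -> V -> k) U : cosub U -> trisym T ->
  (forall v, U v -> T v v v = 0) ->
  exists d (l : nat -> V -> k) (Q : nat -> V -> V -> k),
    [/\ forall j, lfun (l j), forall j u v, Q j u v = Q j v u &
    forall u v w, T u v w =
      \sum_(j < d) (l j u * Q j v w + l j v * Q j u w + l j w * Q j u v)].
Proof.
move=> cU; elim: cU T => {}U => [UT|U' l cU IH ll U'E] T tT T0.
  exists 0%N, (fun _ _ => 0), (fun _ _ _ => 0); split=> [j a u v|//|u v w].
    by rewrite mulr0 addr0.
  have n6 : 6%:R != 0 :> k by rewrite (_ : 6 = 2 * 3)%N // natrM mulf_neq0.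
  rewrite big_ord0; apply: (mulfI n6); rewrite tri_polar // !T0 //; ring.
case: (classic (exists2 x, U x & l x <> 0)) => [[x Ux /eqP lx]|H]; last first.
  apply: IH => // v Uv; apply: T0; apply/U'E; split=> //.
  by apply: NNPP => lv; apply: H; exists v.
have sU := cosub_subsp cU.
pose v0 := (l x)^-1 *: x.
have lv0 : l v0 = 1 by rewrite lfunZ // mulVf.
have Uv0 : U v0 by apply: (subspZ _ sU).
pose T' u v w := T u v w - (l u * T v0 v w + l v * T v0 u w + l w * T v0 u v)
  + (l u * l v * T v0 v0 w + l u * l w * T v0 v0 v + l v * l w * T v0 v0 u)
  - l u * l v * l w * T v0 v0 v0.
have [|| d [m [Q [lm Qs T'E]]]] := IH T'.
- split=> [v w a u u'|u v w|u v w]; rewrite /T'.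
  + rewrite ll (tril1 tT) !(tril2 tT v0 v) !(tril2 tT v0 w) !(tril3 tT v0 v0); ring.
  + by rewrite (triC12 tT u v w) (triC23 tT v0 u v); ring.
  by rewrite (triC23 tT u v w) (triC23 tT v0 v w); ring.
- move=> v Uv; have -> : T' v v v = T (v + - l v *: v0) (v + - l v *: v0) (v + - l v *: v0).
    by rewrite cubeD // (triC13 tT v v v0) (triC13 tT v v0 v0) /T'; ring.
  apply: T0; apply/U'E; rewrite addrC; split; first exact: sU.2.
  by rewrite ll lv0 mulr1 addNr.
(* Symmetrizing against [l] repeats the later terms twice and three times; the weights 1/2 and 1/3
   compensate. *)
pose h v w := T v0 v w - 2%:R^-1 * (l v * T v0 v0 w + l w * T v0 v0 v)
  + 3%:R^-1 * (l v * l w * T v0 v0 v0).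
exists d.+1, (fun j => if j is i.+1 then m i else l),
  (fun j => if j is i.+1 then Q i else h); split=> [[|j]|[|j] u v|u v w] //.
  by rewrite /h (triC23 tT v0 u v); ring.
rewrite big_ord_recl /=; under eq_bigr => i _ do rewrite add0n.
by rewrite -T'E /T' /h; field; rewrite n2 n3.
Qed.

End FiniteRank.

(** * Finitely supported vectors as a module, with its linear and trilinear forms *)

Section Vec.
Variables (k : fieldType) (I : choiceType).
Local Notation vec := (vec k I).
Implicit Types (u v w : vec) (i j : I) (h : I -> k).

Lemma vlincombE (a : k) u v i : vlincomb a u v i = a * u i + v i.
Proof.
rewrite /vlincomb fsfunE inE; case: (finsuppP u) => //; case: (finsuppP v) => //=.
by rewrite mulr0 addr0.
Qed.

Definition vec0 : vec := [fsfun].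
Definition vadd u v := vlincomb 1 u v.
Definition vopp u := vlincomb (-1) u vec0.
Definition vscale (a : k) u := vlincomb a u vec0.

Lemma vec0E i : vec0 i = 0. Proof. by rewrite fsfunE. Qed.

Fact vaddA : associative vadd.
Proof. by move=> u v w; apply/fsfunP => i; rewrite !vlincombE; ring. Qed.
Fact vaddC : commutative vadd.
Proof. by move=> u v; apply/fsfunP => i; rewrite !vlincombE; ring. Qed.
Fact vadd0 : left_id vec0 vadd.
Proof. by move=> u; apply/fsfunP => i; rewrite !vlincombE vec0E; ring. Qed.
Fact vaddN : left_inverse vec0 vopp vadd.
Proof. by move=> u; apply/fsfunP => i; rewrite !vlincombE !vec0E; ring. Qed.

HB.instance Definition _ := Choice.on vec.
HB.instance Definition _ := GRing.isZmodule.Build vec vaddA vaddC vadd0 vaddN.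

Fact vscaleA (a b : k) u : vscale a (vscale b u) = vscale (a * b) u.
Proof. by apply/fsfunP => i; rewrite !vlincombE !vec0E; ring. Qed.
Fact vscale1 : left_id 1 vscale.
Proof. by move=> u; apply/fsfunP => i; rewrite !vlincombE !vec0E; ring. Qed.
Fact vscaleDr : right_distributive vscale +%R.
Proof. by move=> a u v; apply/fsfunP => i; rewrite !vlincombE !vec0E; ring. Qed.
Fact vscaleDl u : {morph vscale^~ u : a b / a + b}.
Proof. by move=> a b; apply/fsfunP => i; rewrite !vlincombE !vec0E; ring. Qed.

HB.instance Definition _ :=
  GRing.Zmodule_isLmodule.Build k vec vscaleA vscale1 vscaleDr vscaleDl.

Lemma vlincomb_lmod (a : k) u v : vlincomb a u v = a *: u + v.
Proof. by apply/fsfunP => i; rewrite !vlincombE vec0E; ring. Qed.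

Lemma vec_coord i : lfun (fun v : vec => v i).
Proof. by move=> a u v; rewrite -vlincomb_lmod vlincombE. Qed.

Definition bvec i : vec := [fsfun x in [fset i] => 1].

Lemma bvecE i j : bvec i j = (j == i)%:R.
Proof. by rewrite fsfunE inE; case: eqP. Qed.

(** The functional with values [h] on the basis; [h] may have infinite support. *)
Definition lin (h : I -> k) u : k := \sum_(i <- finsupp u) u i * h i.

Lemma lin_widen h u (S : {fset I}) : finsupp u `<=` S ->
  lin h u = \sum_(i <- S) u i * h i.
Proof.
move=> uS; rewrite /lin (big_fsetID _ (mem (finsupp u)) S) /=.
rewrite [X in _ = _ + X]big1_fset ?addr0 => [|i].
  apply: eq_fbigl => i; rewrite !inE /= andbC; case: (boolP (i \in finsupp u)) => //=.
  by move/(fsubsetP uS)->.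
by rewrite !inE /= => /andP[_ iu] _; rewrite fsfun_dflt // mul0r.
Qed.

Lemma lin_lfun h : lfun (lin h).
Proof.
move=> a u v; pose S := finsupp u `|` finsupp v `|` finsupp (a *: u + v).
have Su : finsupp u `<=` S by rewrite /S -fsetUA fsubsetUl.
have Sv : finsupp v `<=` S by rewrite /S fsubsetU // fsubsetUr.
have Suv : finsupp (a *: u + v) `<=` S by rewrite fsubsetUr.
rewrite (lin_widen _ Su) (lin_widen _ Sv) (lin_widen _ Suv) mulr_sumr -big_split /=.
by apply: eq_bigr => i _; rewrite vec_coord; ring.
Qed.

Lemma vec_sum u : u = \sum_(i <- finsupp u) u i *: bvec i.
Proof.
apply/fsfunP => j; rewrite (lfun_sum _ _ _ (vec_coord j)).
under eq_bigr => i _ do rewrite bvecE.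
case: (finsuppP u j) => [ju|ju]; last first.
  rewrite (big_fsetD1 j) //= eqxx mulr1 big1_fset ?addr0 // => i.
  by rewrite !inE eq_sym => /andP[/negPf-> _] _; rewrite mulr0.
rewrite big_seq big1 // => i iu; case: eqP => [ji|]; last by rewrite mulr0.
by rewrite ji iu in ju.
Qed.

Lemma lfun_lin (l : vec -> k) u : lfun l -> l u = lin (fun i => l (bvec i)) u.
Proof. by move=> ll; rewrite {1}[u]vec_sum lfun_sum. Qed.

Lemma lin_bvec h i : lin h (bvec i) = h i.
Proof.
have S : finsupp (bvec i) `<=` [fset i].
  apply/fsubsetP => j; rewrite mem_finsupp bvecE inE.
  by case: (j == i) => //; rewrite mulr0n eqxx.
by rewrite (lin_widen _ S) big_seq_fset1 bvecE eqxx mul1r.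
Qed.

Lemma lin_exchange (H : I -> I -> k) u v :
  lin (fun i => lin (H i) v) u = lin (fun j => lin (H^~ j) u) v.
Proof.
rewrite /lin; under eq_bigr => i _ do rewrite mulr_sumr.
rewrite exchange_big; apply: eq_bigr => j _ /=; rewrite mulr_sumr.
by apply: eq_bigr => i _; ring.
Qed.

Lemma eq_lin h h' u : h =1 h' -> lin h u = lin h' u.
Proof. by move=> hh'; apply: eq_bigr => i _; rewrite hh'. Qed.

Definition tri (F : I -> I -> I -> k) u v w :=
  lin (fun i => lin (fun j => lin (F i j) w) v) u.

Lemma tri_bvec F i j l : tri F (bvec i) (bvec j) (bvec l) = F i j l.
Proof. by rewrite /tri !lin_bvec. Qed.

Lemma tri_trisym F : (forall i j l, F i j l = F j i l) ->
  (forall i j l, F i j l = F i l j) -> trisym (tri F).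
Proof.
move=> F12 F23; split=> [v w|u v w|u v w].
- exact: lin_lfun.
- by rewrite /tri lin_exchange; apply: eq_lin => i; apply: eq_lin => j;
    apply: eq_lin => l; rewrite F12.
apply: eq_lin => i; rewrite lin_exchange; apply: eq_lin => j; apply: eq_lin => l; exact: F23.
Qed.

End Vec.

(** * Coefficients of products and of formal derivatives *)

Section Monomials.
Variables (k : fieldType) (I : choiceType).
Implicit Types (f g h q : fpoly k I) (m : mono I) (a b c i j l : I) (s : seq I).

Definition smset s : mono I := seq_mset s.

Lemma smset_perm s s' : perm_eq s s' -> smset s = smset s'.
Proof. by move/eq_seq_msetP. Qed.

Lemma smset_enum m : smset (enum_mset m) = m.
Proof. exact: seq_mset_id. Qed.

Lemma enum_smset s : perm_eq (enum_mset (smset s)) s.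
Proof. exact: perm_eq_seq_mset. Qed.

Lemma mdeg_smset s : mdeg (smset s) = size s.
Proof. exact/perm_size/enum_smset. Qed.

Lemma smset1_inj : injective (fun a => smset [:: a]).
Proof.
move=> a b /eq_seq_msetP/perm_mem/(_ a); rewrite !inE eqxx.
by move/esym/eqP.
Qed.

Lemma enum_smset1 a : enum_mset (smset [:: a]) = [:: a] :> seq I.
Proof. exact: perm_small_eq (enum_smset _). Qed.

Lemma perm_pair a b i j : perm_eq [:: i; j] [:: a; b] ->
  (i = a /\ j = b) \/ (i = b /\ j = a).
Proof.
move=> p; have /perm_mem/(_ i) := p; rewrite !inE eqxx => /esym/orP[]/eqP E; subst i.
  by left; move: p; rewrite perm_cons => /(perm_small_eq (isT : (size [:: b] <= 1)%N))[].
right; have p' : perm_eq [:: a; b] [:: b; a] by rewrite (perm_catC [:: a] [:: b]).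
have := perm_trans p p'.
by rewrite perm_cons => /(perm_small_eq (isT : (size [:: a] <= 1)%N))[->].
Qed.

Lemma perm_triple (T : Type) (H : I -> I -> I -> T) a b c i j l :
  (forall a b c, H a b c = H b a c) -> (forall a b c, H a b c = H a c b) ->
  perm_eq [:: i; j; l] [:: a; b; c] -> H i j l = H a b c.
Proof.
move=> H12 H23 p; have /perm_mem/(_ i) := p; rewrite !inE eqxx => /esym.
have pr x a' b' : perm_eq [:: x; j; l] [:: x; a'; b'] -> H x j l = H x a' b'.
  by rewrite perm_cons => /perm_pair[] [-> ->].
case/or3P=> /eqP E; subst i; first exact: pr.
  rewrite [RHS]H12; apply: pr; apply: perm_trans p _.
  by rewrite (perm_catCA [:: a] [:: b] [:: c]).
rewrite [RHS]H23 [RHS]H12; apply: pr; apply: perm_trans p _.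
by rewrite (perm_catC [:: a; b] [:: c]).
Qed.

(* Coefficients of the polarised forms, without the factors 1/2 and 1/6: these are
   the iterated formal derivatives. *)
Definition pol2 q a b : k := (a == b).+1%:R * q (smset [:: a; b]).
Definition pol3 f i a b : k := pol2 (dpart i f) a b.

Lemma pol2C q a b : pol2 q a b = pol2 q b a.
Proof.
by rewrite /pol2 eq_sym; congr (_ * q _); apply: smset_perm; rewrite (perm_catC [:: a] [:: b]).
Qed.

Lemma dpart_smset i f s : dpart i f (smset s) = (count_mem i s).+1%:R * f (smset (i :: s)).
Proof. by rewrite /dpart mset_seqE /smset mset_cons. Qed.

Lemma pol3E f i a b : pol3 f i a b =
  ((a == b).+1 * ((a == i) + (b == i)).+1)%N%:R * f (smset [:: i; a; b]).
Proof. by rewrite /pol3 /pol2 dpart_smset /= addn0 mulrA natrM. Qed.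

Lemma pol3C23 f i a b : pol3 f i a b = pol3 f i b a.
Proof. exact: pol2C. Qed.

Lemma pol3C12 f i a b : pol3 f i a b = pol3 f a i b.
Proof.
rewrite !pol3E; congr (_%:R * f _); last first.
  by apply: smset_perm; rewrite (perm_catCA [:: i] [:: a] [:: b]).
rewrite (eq_sym i a) (eq_sym i b).
case: (eqVneq a i) => [->|ai]; first by rewrite (eq_sym i b).
case: (eqVneq b i) => [->|bi]; first by rewrite (eq_sym i a) (negPf ai).
by rewrite (eq_sym b a) mul1n muln1.
Qed.

Lemma mem_submsets1 a m : (smset [:: a] \in submsets m) = (a \in enum_mset m).
Proof.
rewrite mem_undup; apply/mapP/idP => [[t _ /eq_seq_msetP/perm_mem/(_ a)]|am].
  by rewrite inE eqxx => /esym/mem_mask.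
have /subseqP[t st ta] : subseq [:: a] (enum_mset m) by rewrite sub1seq.
have st' : size t == mdeg m by rewrite st.
by exists (Tuple st'); rewrite ?mem_enum //= -ta.
Qed.

Lemma deg1P m : mdeg m = 1%N -> exists a, m = smset [:: a].
Proof.
rewrite -{2}(smset_enum m) /mdeg; case: (enum_mset m) => [|a [|]] // _.
by exists a.
Qed.

(** Since [g] has degree 1, only singleton submultisets contribute, one for each distinct letter. *)
Lemma mulp_smset g h s : homogp 1 g -> mulp g h (smset s) =
  \sum_(a <- undup s) g (smset [:: a]) * h (smset (rem a s)).
Proof.
move=> hg; pose L := [seq smset [:: a] | a <- undup (enum_mset (smset s))].
transitivity (\sum_(m <- L) g m * h (msetB (smset s) m)).
  rewrite /mulp (bigID (mem L)) /= [X in _ + X]big1_seq ?addr0 => [|m /andP[mL ms]].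
    rewrite -big_filter; apply: perm_big; apply: uniq_perm.
    - by rewrite filter_uniq // undup_uniq.
    - by rewrite map_inj_uniq ?undup_uniq //; exact: smset1_inj.
    move=> m; rewrite mem_filter andb_idr // => /mapP[a]; rewrite mem_undup => am ->.
    by rewrite mem_submsets1.
  have [->|/hg/deg1P[a mE]] := eqVneq (g m) 0; first by rewrite mul0r.
  case/negP: mL; rewrite mE; apply: (map_f (fun a => smset [:: a])).
  by rewrite mem_undup -mem_submsets1 -mE.
rewrite /L big_map (perm_big (undup s)); last first.
  by apply: perm_undup; exact: perm_mem (enum_smset s).
apply: eq_big_seq => a; rewrite mem_undup => sa; congr (_ * h _).
apply/msetP => b; rewrite msetE2 !mset_seqE count_rem sa /= addn0 eq_sym.
by [].
Qed.

Lemma homog_mulp g h n : homogp 1 g -> homogp n h -> homogp n.+1 (mulp g h).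
Proof.
move=> hg hh m; rewrite -{1 2}(smset_enum m) mulp_smset // mdeg_smset.
set s := enum_mset m => nz; apply/eqP/negPn/negP=> sn.
case/negP: nz; apply/eqP; apply: big1_seq => a /andP[_]; rewrite mem_undup => sa.
have [->|/hh] := eqVneq (h (smset (rem a s))) 0; first by rewrite mulr0.
rewrite mdeg_smset size_rem // => E; case/eqP: sn; rewrite -E.
by case: (s) sa.
Qed.

Lemma pol2_mulp g h a b : homogp 1 g -> pol2 (mulp g h) a b =
  g (smset [:: a]) * h (smset [:: b]) + g (smset [:: b]) * h (smset [:: a]).
Proof.
move=> hg; rewrite /pol2 mulp_smset //= !inE; case: (eqVneq a b) => [->|ab].
  by rewrite big_seq1 /= eqxx; ring.
by rewrite big_cons big_seq1 /= !eqxx (negPf ab) mul1r.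
Qed.

(** The product rule, with exactly one of three derivatives falling on the linear factor; the cases
    are coincidences among indices. *)
Lemma pol3_mulp g h a b c : homogp 1 g -> pol3 (mulp g h) a b c =
  g (smset [:: a]) * pol2 h b c + g (smset [:: b]) * pol2 h a c
  + g (smset [:: c]) * pol2 h a b.
Proof.
move=> hg; rewrite pol3E mulp_smset //= !inE /pol2.
have hC x y : h (smset [:: x; y]) = h (smset [:: y; x]).
  by congr h; apply: smset_perm; rewrite (perm_catC [:: x] [:: y]).
rewrite !(eq_sym b a) !(eq_sym c a).
have [ab|ab] := eqVneq a b; [subst b|]; have [ac|ac] := eqVneq a c; [subst c| |subst c|].
- by rewrite ?eqxx /= big_seq1 /= eqxx; ring.
- by rewrite ?(negPf ac) /= big_cons big_seq1 /= ?eqxx ?(negPf ac) (hC a c); ring.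
- rewrite [b == a]eq_sym ?(negPf ab) /= big_cons big_seq1 /= ?eqxx ?(negPf ab) (hC b a); ring.
have [bc|bc] := eqVneq b c; [subst c|].
  by rewrite big_cons big_seq1 /= ?eqxx ?(negPf ab); ring.
by rewrite !big_cons big_nil /= ?eqxx ?(negPf ab) ?(negPf ac) ?(negPf bc); ring.
Qed.

End Monomials.

(** * Strength in terms of subspaces of finite codimension *)

Section Strength.
Variables (k : fieldType) (I : choiceType).
Hypotheses (n2 : 2%:R != 0 :> k) (n3 : 3%:R != 0 :> k).
Implicit Types (f g h q : fpoly k I) (m : mono I) (a b c i : I).

Lemma natr6_neq0 : 6%:R != 0 :> k.
Proof. by rewrite (_ : 6 = 2 * 3)%N // natrM mulf_neq0. Qed.

Definition fpoly1 (h : I -> k) : fpoly k I :=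
  fun m => if enum_mset m is [:: a] then h a else 0.

(** The inverse factor undoes the multiplicity in [pol2]; for symmetric [Q] the order in which the
    multiset is enumerated is immaterial. *)
Definition fpoly2 (Q : I -> I -> k) : fpoly k I :=
  fun m => if enum_mset m is [:: a; b] then (a == b).+1%:R^-1 * Q a b else 0.

Lemma homog_fpoly1 (h : I -> k) : homogp 1 (fpoly1 h).
Proof.
by move=> m; rewrite /fpoly1 /mdeg; case: (enum_mset m) => [|a [|]] //=; rewrite eqxx.
Qed.

Lemma homog_fpoly2 Q : homogp 2 (fpoly2 Q).
Proof.
by move=> m; rewrite /fpoly2 /mdeg; case: (enum_mset m) => [|a [|b []]] //=; rewrite eqxx.
Qed.

Lemma fpoly1E (h : I -> k) a : fpoly1 h (smset [:: a]) = h a.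
Proof. by rewrite /fpoly1 enum_smset1. Qed.

Lemma pol2_fpoly2 Q a b : (forall a b, Q a b = Q b a) -> pol2 (fpoly2 Q) a b = Q a b.
Proof.
move=> Qs; rewrite /pol2 /fpoly2; have := enum_smset [:: a; b].
have ws : (a == b).+1%:R != 0 :> k by case: (a == b); rewrite ?n2 ?oner_neq0.
case E : (enum_mset _) => [|x [|y [|z r]]] p; try by have := perm_size p.
have [[-> ->]|[-> ->]] := perm_pair p; first by rewrite mulVKf.
by rewrite (eq_sym b a) mulVKf.
Qed.

Lemma pol2_sum d (c : 'I_d -> k) (q : 'I_d -> fpoly k I) a b :
  pol2 (fun m => \sum_(j < d) c j * q j m) a b = \sum_(j < d) c j * pol2 (q j) a b.
Proof. by rewrite /pol2 mulr_sumr; apply: eq_bigr => j _; ring. Qed.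

Lemma homog2_ext q q' : homogp 2 q -> homogp 2 q' ->
  (forall a b, pol2 q a b = pol2 q' a b) -> forall m, q m = q' m.
Proof.
move=> hq hq' E m; have [m2|m2] := eqVneq (mdeg m) 2%N; last first.
  have [->|/hq m2'] := eqVneq (q m) 0; last by rewrite m2' eqxx in m2.
  by have [->|/hq' m2'] := eqVneq (q' m) 0; last by rewrite m2' eqxx in m2.
rewrite -(smset_enum m); move: m2; rewrite /mdeg.
case: (enum_mset m) => [|a [|b [|]]] // _; move: (E a b); apply: mulfI.
by case: (a == b); rewrite ?n2 ?oner_neq0.
Qed.

(** The multiplicity in [pol3E] is 1, 2 or 6, hence invertible. *)
Lemma homog3_ext f f' : homogp 3 f -> homogp 3 f' ->
  (forall a b c, pol3 f a b c = pol3 f' a b c) -> forall m, f m = f' m.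
Proof.
move=> hf hf' E m; have [m3|m3] := eqVneq (mdeg m) 3%N; last first.
  have [->|/hf m3'] := eqVneq (f m) 0; last by rewrite m3' eqxx in m3.
  by have [->|/hf' m3'] := eqVneq (f' m) 0; last by rewrite m3' eqxx in m3.
rewrite -(smset_enum m); move: m3; rewrite /mdeg.
case: (enum_mset m) => [|a [|b [|c [|]]]] // _; move: (E a b c); rewrite !pol3E; apply: mulfI.
by rewrite natrM mulf_neq0 //; case: (b == c); case: (b == a); case: (c == a);
  rewrite ?n2 ?n3 ?oner_neq0.
Qed.

Lemma homog_sum n d (q : 'I_d -> fpoly k I) : (forall j, homogp n (q j)) ->
  homogp n (fun m => \sum_(j < d) q j m).
Proof.
move=> hq m nz; apply/eqP/negPn/negP => mn; case/negP: nz; apply/eqP; apply: big1 => j _.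
by have [//|/hq E] := eqVneq (q j m) 0; rewrite E eqxx in mn.
Qed.

Definition bil (H : I -> I -> k) (u v : vec k I) := lin (fun a => lin (H a) v) u.

(** Factors of degree between 0 and 2 are linear, so a finite sum of products vanishes on the common
    kernel of its first factors. The converse is [finite_rank_quad]. *)
Lemma finite_strength2P q : homogp 2 q ->
  finite_strength 2 q <-> exists2 U, cosub U & forall v, U v -> bil (pol2 q) v v = 0.
Proof.
move=> hq; split=> [[d [gs [hs [hgh qE]]]]|[U cU U0]].
  have hg j : homogp 1 (gs j).
    have [x [y [xx _ + _]]] := hgh j; suff -> : x = 1%N by [].
    by case: x xx => [|[|x]].
  pose G j a := gs j (smset [:: a]); pose H j a := hs j (smset [:: a]).
  exists (fun v => forall j, j \in enum 'I_d -> lin (G j) v = 0).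
    by apply: cosub_all => j _; apply: cosub_ker; apply: lin_lfun.
  move=> v Gv; transitivity (\sum_(j < d) (2%:R * lin (G j) v * lin (H j) v)).
    transitivity (lin (fun a => \sum_(j < d) (G j a * lin (H j) v + lin (G j) v * H j a)) v).
      apply: eq_lin => a.
      transitivity (lin (fun b => \sum_(j < d) (G j a * H j b + G j b * H j a)) v).
        apply: eq_lin => b; rewrite /pol2 qE mulr_sumr; apply: eq_bigr => j _.
        by rewrite -[LHS]/(pol2 _ a b) pol2_mulp.
      rewrite /lin; under eq_bigr => b _ do rewrite mulr_sumr.
      rewrite exchange_big; apply: eq_bigr => j _ /=; rewrite mulr_sumr mulr_suml -big_split.
      by apply: eq_bigr => b _ /=; ring.
    rewrite {1}/lin; under eq_bigr => b _ do rewrite mulr_sumr.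
    rewrite exchange_big; apply: eq_bigr => j _ /=; rewrite [in RHS]/lin.
    transitivity (\sum_(b <- finsupp v) v b * G j b * lin (H j) v
       + \sum_(b <- finsupp v) lin (G j) v * (v b * H j b)).
      by rewrite -big_split; apply: eq_bigr => b _ /=; ring.
    by rewrite -mulr_suml -mulr_sumr /lin; ring.
  by rewrite big1 // => j _; rewrite Gv ?mem_enum // mulr0 mul0r.
have [|| d [l [l' [ll ll' E]]]] := finite_rank_quad n2 cU _ _ U0.
- by move=> v; exact: lin_lfun.
- move=> u v; rewrite /bil lin_exchange; apply: eq_lin => a; apply: eq_lin => b.
  exact: pol2C.
exists d, (fun j => fpoly1 (fun a => l j (bvec k a))), (fun j => fpoly1 (fun a => l' j (bvec k a))).
split=> [j|]; first by exists 1%N, 1%N; split=> //; apply: homog_fpoly1.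
apply: homog2_ext => //.
  by apply: homog_sum => j; apply: homog_mulp; apply: homog_fpoly1.
move=> a b; transitivity (bil (pol2 q) (bvec k a) (bvec k b)).
  by rewrite /bil !lin_bvec.
rewrite E /pol2 mulr_sumr; apply: eq_bigr => j _.
rewrite -[RHS]/(pol2 _ a b) pol2_mulp ?fpoly1E; last exact: homog_fpoly1.
by rewrite mulrC [X in X + _]mulrC; ring.
Qed.

Lemma pol3_trisym f : trisym (tri (pol3 f)).
Proof. by apply: tri_trisym => *; [exact: pol3C12 | exact: pol3C23]. Qed.

(** Otherwise [finite_rank_cubic] would write f as a finite sum of linear times quadratic forms. *)
Lemma nondeg_cosub f : homogp 3 f -> cubic_nondeg f ->
  forall U, cosub U -> exists2 v, U v & tri (pol3 f) v v v != 0.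
Proof.
move=> hf nd U cU; apply: NNPP => H; apply: nd.
have tT := pol3_trisym f.
have U0 v : U v -> tri (pol3 f) v v v = 0.
  by move=> Uv; apply/eqP/negPn/negP => nz; apply: H; exists v.
have [d [l [Q [ll Qs E]]]] := finite_rank_cubic n2 n3 cU tT U0.
exists d, (fun j => fpoly1 (fun a => l j (bvec k a))),
  (fun j => fpoly2 (fun a b => Q j (bvec k a) (bvec k b))).
split=> [j|].
  by exists 1%N, 2%N; split=> //; [apply: homog_fpoly1 | apply: homog_fpoly2].
apply: homog3_ext => //.
  by apply: homog_sum => j; apply: homog_mulp; [apply: homog_fpoly1 | apply: homog_fpoly2].
move=> a b c; rewrite -tri_bvec E [RHS]pol3E mulr_sumr; apply: eq_bigr => j _.
rewrite -[RHS]pol3E pol3_mulp ?fpoly1E; last exact: homog_fpoly1.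
by rewrite !pol2_fpoly2.
Qed.

Lemma homog_dpart i f n : homogp n.+1 f -> homogp n (dpart i f).
Proof.
move=> hf m; rewrite -{1 2}(smset_enum m) dpart_smset mulf_eq0 negb_or => /andP[_ /hf].
by rewrite !mdeg_smset => -[].
Qed.

(** Contracting the trilinear form with a combination of basis vectors gives the polarization of the
    same combination of partial derivatives. This moves the residual rank from derivatives to
    vectors modulo K. *)
Lemma derivative_finrk f r (ix : 'I_r -> I) (c : 'I_r -> k) : homogp 3 f ->
  finite_strength 2 (fun m => \sum_(j < r) c j * dpart (ix j) f m) <->
  finrk (tri (pol3 f)) (\sum_(j < r) c j *: bvec k (ix j)).
Proof.
move=> hf; rewrite finite_strength2P; last first.
  apply: homog_sum => j m; rewrite mulf_eq0 negb_or => /andP[_].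
  exact: homog_dpart.
have E v : bil (pol2 (fun m => \sum_(j < r) c j * dpart (ix j) f m)) v v =
    tri (pol3 f) (\sum_(j < r) c j *: bvec k (ix j)) v v.
  rewrite [RHS](lfun_sum _ _ _ (lin_lfun _)); under [RHS]eq_bigr => j _ do rewrite lin_bvec.
  transitivity (lin (fun a => \sum_(j < r) c j * lin (pol3 f (ix j) a) v) v).
    apply: eq_lin => a; rewrite (eq_lin _ (pol2_sum _ _ a)) /lin.
    under eq_bigr => b _ do rewrite mulr_sumr.
    rewrite exchange_big; apply: eq_bigr => j _ /=; rewrite mulr_sumr.
    by apply: eq_bigr => b _; rewrite /pol3; ring.
  transitivity (\sum_(b <- finsupp v) v b * \sum_(j < r) c j * lin (pol3 f (ix j) b) v).
    by [].
  under [LHS]eq_bigr => b _ do rewrite mulr_sumr.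
  rewrite [LHS]exchange_big; apply: eq_bigr => j _ /=.
  transitivity (c j * \sum_(b <- finsupp v) v b * lin (pol3 f (ix j) b) v); last by [].
  by rewrite mulr_sumr; apply: eq_bigr => b _; ring.
by split=> -[U cU U0]; exists U => // v /U0; rewrite E.
Qed.

End Strength.

(** * Evaluation on the diagonal of the trilinear form *)

Section Evaluation.
Variables (k : fieldType) (I : choiceType).
Implicit Types (f : fpoly k I) (v : vec k I) (a b c i j l : I).

(* The permanent of the 3 x 3 matrix of incidences counts the orderings of a
   monomial with the multiplicity that [pol3] attaches to it. *)
Lemma incidence_permanent a b c i j l :
  let R i j l := ((i == a) * (j == b) * (l == c) + (i == a) * (j == c) * (l == b)
    + (i == b) * (j == a) * (l == c) + (i == b) * (j == c) * (l == a)
    + (i == c) * (j == a) * (l == b) + (i == c) * (j == b) * (l == a))%N in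
  R i j l = (perm_eq [:: i; j; l] [:: a; b; c] * ((b == c).+1 * ((b == a) + (c == a)).+1))%N.
Proof.
move=> R; have R12 x y z : R x y z = R y x z by rewrite /R; lia.
have R23 x y z : R x y z = R x z y by rewrite /R; lia.
have Rabc : R a b c = ((b == c).+1 * ((b == a) + (c == a)).+1)%N.
  rewrite /R !eqxx (eq_sym c b) (eq_sym a b) (eq_sym a c).
  case: (eqVneq b c) => [bc|_]; last by case: (b == a); case: (c == a).
  by rewrite bc; case: (c == a).
case: (boolP (perm_eq _ _)) => p; first by rewrite (perm_triple R12 R23 p) Rabc mul1n.
have R0 x y z : perm_eq [:: x; y; z] [:: a; b; c] ->
    ((i == x) * (j == y) * (l == z) = 0)%N.
  move=> q; case: eqP => // ix; case: eqP => // jy; case: eqP => // lz.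
  by case/negP: p; rewrite ix jy lz.
have p1 : perm_eq [:: a; c; b] [:: a; b; c] by rewrite perm_cons (perm_catC [:: c] [:: b]).
have p2 : perm_eq [:: b; a; c] [:: a; b; c] by rewrite (perm_catCA [:: b] [:: a] [:: c]).
have p3 : perm_eq [:: b; c; a] [:: a; b; c] by rewrite (perm_catC [:: b; c] [:: a]).
have p4 : perm_eq [:: c; a; b] [:: a; b; c] by rewrite (perm_catC [:: c] [:: a; b]).
have p5 : perm_eq [:: c; b; a] [:: a; b; c].
  by apply: perm_trans p3; rewrite (perm_catCA [:: c] [:: b] [:: a]).
by rewrite /R !R0.
Qed.

(** Ordered triples of indices are regrouped by the monomial they form; the multiplicities come from
    [incidence_permanent]. *)
Lemma evaln3 f v : 6%:R * evaln 3 f v = tri (pol3 f) v v v.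
Proof.
pose S := finsupp v; pose H i j l := pol3 f i j l * (v i * v j * v l).
pose Lm := undup [seq smset (map val (val t)) | t <- enum {: 3.-tuple (finsupp v)}].
have triE : tri (pol3 f) v v v = \sum_(i <- S) \sum_(j <- S) \sum_(l <- S) H i j l.
  rewrite /tri /lin; apply: eq_bigr => i _; rewrite mulr_sumr; apply: eq_bigr => j _.
  by rewrite !mulr_sumr; apply: eq_bigr => l _; rewrite /H; ring.
have inL i j l : i \in S -> j \in S -> l \in S -> smset [:: i; j; l] \in Lm.
  move=> iS jS lS; rewrite mem_undup; apply/mapP.
  by exists [tuple [` iS]; [` jS]; [` lS]]; rewrite ?mem_enum.
transitivity (\sum_(m <- Lm) \sum_(i <- S) \sum_(j <- S) \sum_(l <- S)
    (m == smset [:: i; j; l])%:R * H i j l); last first.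
  rewrite triE exchange_big; apply: eq_big_seq => i iS /=.
  rewrite exchange_big; apply: eq_big_seq => j jS /=.
  rewrite exchange_big; apply: eq_big_seq => l lS /=.
  rewrite (bigD1_seq _ (inL i j l iS jS lS) (undup_uniq _)) /= eqxx mul1r big1 ?addr0 //.
  by move=> m /negPf->; rewrite mul0r.
rewrite /evaln mulr_sumr; apply: eq_big_seq => m; rewrite mem_undup.
case/mapP=> -[[|a' [|b' [|c' [|]]]] //= _] _ ->.
move: (valP a') (valP b') (valP c') => /=.
move: (val a') (val b') (val c') => a b c {a' b' c'} aS bS cS; rewrite -/(smset _).
rewrite (perm_big _ (enum_smset _)) /= !big_cons big_nil mulr1.
pose w := ((b == c).+1 * ((b == a) + (c == a)).+1)%N.
have HE : H a b c = w%:R * f (smset [:: a; b; c]) * (v a * v b * v c) by rewrite /H pol3E.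
transitivity (\sum_(i <- S) \sum_(j <- S) \sum_(l <- S)
   (perm_eq [:: i; j; l] [:: a; b; c] * w)%N%:R *
     (f (smset [:: a; b; c]) * (v a * v b * v c))); last first.
  apply: eq_bigr => i _; apply: eq_bigr => j _; apply: eq_bigr => l _.
  have -> : (smset [:: a; b; c] == smset [:: i; j; l]) = perm_eq [:: i; j; l] [:: a; b; c].
    by rewrite perm_sym; apply/eqP/idP => [/eq_seq_msetP|/smset_perm].
  case: (boolP (perm_eq _ _)) => [p|_]; last by rewrite !mul0r.
  rewrite !mul1n mul1r (perm_triple (H := H) _ _ p) ?HE ?mulrA // => x y z; rewrite /H.
    by rewrite pol3C12; ring.
  by rewrite pol3C23; ring.
under eq_bigr => i _ do under eq_bigr => j _ do rewrite -mulr_suml.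
under eq_bigr => i _ do rewrite -mulr_suml.
rewrite -mulr_suml [v a * (v b * v c)]mulrA; congr (_ * _).
under eq_bigr => i _ do under eq_bigr => j _ do under eq_bigr => l _ do
  rewrite -incidence_permanent.
(* Each of the six terms of the permanent sums to 1 over the support, which yields the factor 6. *)
have one x : x \in S -> \sum_(i <- S) (i == x)%:R = 1 :> k.
  move=> xS; rewrite (big_fsetD1 x) //= eqxx big1_fset ?addr0 // => i.
  by rewrite !inE => /andP[/negPf-> _].
have three x y z : x \in S -> y \in S -> z \in S -> \sum_(i <- S) \sum_(j <- S)
    \sum_(l <- S) ((i == x) * (j == y) * (l == z))%N%:R = 1 :> k.
  move=> xS yS zS; rewrite -[RHS](one x xS); apply: eq_bigr => i _.
  rewrite -[RHS]mulr1 -[X in _ = _ * X](one y yS) mulr_sumr; apply: eq_bigr => j _.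
  rewrite -[RHS]mulr1 -[X in _ = _ * X](one z zS) mulr_sumr; apply: eq_bigr => l _.
  by rewrite !natrM.
have split3 (X Y : I -> I -> I -> nat) :
    \sum_(i <- S) \sum_(j <- S) \sum_(l <- S) (X i j l + Y i j l)%N%:R =
    \sum_(i <- S) \sum_(j <- S) \sum_(l <- S) (X i j l)%:R
    + \sum_(i <- S) \sum_(j <- S) \sum_(l <- S) (Y i j l)%:R :> k.
  rewrite -big_split; apply: eq_bigr => i _; rewrite -big_split; apply: eq_bigr => j _.
  by rewrite -big_split; apply: eq_bigr => l _; rewrite natrD.
by rewrite !split3 !three //; ring.
Qed.

End Evaluation.

(** * Residual rank and embeddings *)

Section ResidualRank.
Variables (k : fieldType) (I : choiceType) (f : fpoly k I).
Hypotheses (n2 : 2%:R != 0 :> k) (hf : homogp 3 f).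
Local Notation B := (tri (pol3 f)).

(** [rrk_ge f 0] is vacuous, so either every [rrk_ge f r] holds or some step from r to r + 1 fails;
    the specification is thus satisfiable. *)
Lemma is_rrk_rrk : is_rrk f (rrk f).
Proof.
apply: (epsilon_spec (inhabits None) (is_rrk f)).
case: (classic (forall r, rrk_ge f r)) => [H|nH]; first by exists None.
apply: NNPP => H; apply: nH; elim=> [|r IH].
  have e0 : 'I_0 -> False by case.
  by exists (fun i => False_rect I (e0 i)) => c _ j; case: (e0 j).
by apply: NNPP => nr; apply: H; exists (Some r).
Qed.

Lemma rrk_geP r : rrk_ge f r <->
  exists2 xs : seq I, size xs = r & indepK B [seq bvec k i | i <- xs].
Proof.
split=> [[ix ind]|[xs sz ind]].
  exists [tuple ix j | j < r]; first by rewrite size_tuple.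
  move=> c; rewrite size_map size_tuple => Kc i ir.
  apply: (ind (fun j => c j) _ (Ordinal ir)); apply/derivative_finrk => //.
  suff -> : \sum_(j < r) c j *: bvec k (ix j) =
      \sum_(j < r) c j *: [seq bvec k i | i <- [tuple ix j | j < r]]`_j by [].
  apply: eq_bigr => j _; congr (_ *: _).
  by rewrite (nth_map (ix j)) ?size_tuple // -tnth_nth tnth_mktuple.
move/eqP: sz => sz; pose t := Tuple sz.
exists (tnth t) => c /derivative_finrk-/(_ n2 hf) Kc j.
pose c' n := if insub n is Some j' then c j' else 0.
have c'E j' : c' (val j') = c j' by rewrite /c' valK.
rewrite -c'E; apply: ind; last by rewrite size_map (eqP sz); exact: ltn_ord.
rewrite size_map (eqP sz) (_ : \sum_(j < r) _ = \sum_(j < r) c j *: bvec k (tnth t j)) //.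
apply: eq_bigr => l _.
by rewrite c'E (nth_map (tnth t l)) ?(eqP sz) // -(tnth_nth _ t).
Qed.

(** By maximality, a basis vector outside the span modulo K would extend the family to r + 1
    members. *)
Lemma rrk_span r : rrk_ge f r -> ~ rrk_ge f r.+1 ->
  exists (xs : seq I) (coef : nat -> I -> k), [/\ size xs = r,
    indepK B [seq bvec k i | i <- xs] & forall i,
    finrk B (bvec k i - \sum_(n < r) coef n i *: [seq bvec k i | i <- xs]`_n)].
Proof.
move=> /rrk_geP[xs sz ind] nr.
have Hc i : {c : nat -> k |
    finrk B (bvec k i - \sum_(n < r) c n *: [seq bvec k i | i <- xs]`_n)}.
  apply: constructive_indefinite_description.
  have [c] : exists c : nat -> k, finrk B (bvec k i -
      \sum_(n < size [seq bvec k i | i <- xs]) c n *: [seq bvec k i | i <- xs]`_n).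
    apply: (spnK_coord (pol3_trisym f)); apply: NNPP => Di; apply: nr; apply/rrk_geP.
    exists (rcons xs i); first by rewrite size_rcons sz.
    by rewrite map_rcons; apply: indepK_rcons.
  by rewrite size_map sz; exists c.
exists xs, (fun n i => sval (Hc i) n); split=> // i; exact: (svalP (Hc i)).
Qed.

Lemma spnK_all D : (forall i, spnK B D (bvec k i)) -> forall v, spnK B D v.
Proof.
move=> HD v; have sS := spnK_subsp B D; rewrite [v]vec_sum.
by apply: (subsp_sum sS) => i _; apply: (subspZ _ sS).
Qed.

Lemma rrk_span_spnK r (xs : seq I) (coef : nat -> I -> k) : size xs = r ->
  (forall i, finrk B (bvec k i - \sum_(n < r) coef n i *: [seq bvec k i | i <- xs]`_n)) ->
  forall v, spnK B [seq bvec k i | i <- xs] v.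
Proof.
move=> sz Kc; apply: spnK_all => i; have sS := spnK_subsp B [seq bvec k i | i <- xs].
rewrite -(subrK (\sum_(n < r) coef n i *: [seq bvec k i | i <- xs]`_n) (bvec k i)).
apply: (subspD sS); first exact: finrk_spnK.
apply: (subsp_sum sS) => n _; apply: (subspZ _ sS); apply: mem_spnK.
by apply: mem_nth; rewrite size_map sz.
Qed.

Lemma spnK_indep_leq (D : seq (vec k I)) m (y : 'I_m -> vec k I) :
  (forall v, spnK B D v) ->
  (forall c : 'I_m -> k, finrk B (\sum_j c j *: y j) -> forall j, c j = 0) ->
  (m <= size D)%N.
Proof.
move=> HD ind; rewrite leqNgt; apply/negP => lt.
have [|c Kc [j]] := spnK_dependent (pol3_trisym f) (y := fun j : 'I_(size D) => D`_j) (x := y) lt.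
  move=> i; apply: spnK_sub (HD _) => d dD; apply/mapP.
  have dD' : (index d D < size D)%N by rewrite index_mem.
  by exists (Ordinal dD'); rewrite ?mem_enum //= nth_index.
by rewrite (ind c Kc) eqxx.
Qed.

End ResidualRank.

(** * Embeddings from images of basis vectors, and the two directions of the equivalence *)

Section LinearExtension.
Variables (k : fieldType) (I J : choiceType).

Definition vlin (psi : J -> vec k I) (w : vec k J) : vec k I :=
  \sum_(j <- finsupp w) w j *: psi j.

Lemma vlin_coord psi w i : vlin psi w i = lin (fun j => psi j i) w.
Proof. by rewrite /vlin (lfun_sum _ _ _ (vec_coord i)). Qed.

Lemma vlin_linear psi (a : k) (u v : vec k J) :
  vlin psi (a *: u + v) = a *: vlin psi u + vlin psi v.
Proof. by apply/fsfunP => i; rewrite vec_coord !vlin_coord lin_lfun. Qed.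

Lemma vlin_bvec psi j : vlin psi (bvec k j) = psi j.
Proof. by apply/fsfunP => i; rewrite vlin_coord lin_bvec. Qed.

End LinearExtension.

Lemma trisym_ext (k : fieldType) (J : choiceType) (T T' : vec k J -> vec k J -> vec k J -> k) :
  trisym T -> trisym T' ->
  (forall i j l, T (bvec k i) (bvec k j) (bvec k l) = T' (bvec k i) (bvec k j) (bvec k l)) ->
  forall u v w, T u v w = T' u v w.
Proof.
move=> tT tT' E u v w.
rewrite (lfun_lin _ (tril1 tT v w)) (lfun_lin _ (tril1 tT' v w)); apply: eq_lin => i.
rewrite (lfun_lin _ (tril2 tT (bvec k i) w)) (lfun_lin _ (tril2 tT' (bvec k i) w)).
apply: eq_lin => j.
rewrite (lfun_lin _ (tril3 tT (bvec k i) (bvec k j))).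
by rewrite (lfun_lin _ (tril3 tT' (bvec k i) (bvec k j))); apply: eq_lin => l.
Qed.

Section Embedding.
Variables (k : closedFieldType) (I : choiceType) (J : countType).
Variables (f : fpoly k I) (g : fpoly k J).
Hypotheses (n2 : 2%:R != 0 :> k) (n3 : 3%:R != 0 :> k).
Hypotheses (hf : homogp 3 f) (hg : homogp 3 g).
Local Notation Bf := (tri (pol3 f)).
Local Notation Bg := (tri (pol3 g)).

Lemma embeds_of_tri psi :
  (forall i j l, Bf (psi i) (psi j) (psi l) = Bg (bvec k i) (bvec k j) (bvec k l)) ->
  cubic_embeds g f.
Proof.
move=> E; exists (vlin psi); split=> [a u v i|w].
  by rewrite vlincomb_lmod vlin_linear vec_coord.
apply: (mulfI (natr6_neq0 n2 n3)); rewrite !evaln3.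
pose T u v w := Bf (vlin psi u) (vlin psi v) (vlin psi w).
have tf := pol3_trisym f.
apply: (@trisym_ext _ _ T Bg) => [||i j l]; last by rewrite /T !vlin_bvec.
  split=> [v w' a u u'|u v w'|u v w']; rewrite /T ?vlin_linear.
  - exact: (tril1 tf).
  - exact: (triC12 tf).
  exact: (triC23 tf).
exact: pol3_trisym.
Qed.

(** Each basis vector of W is a combination of the [ws]; its image is the same combination of the
    [v]. Positions from [r] on are reserved for the enumerated basis. *)
Lemma embeds_of_sequence s r (a : nat -> J -> k) (ws : nat -> vec k J) (v : nat -> vec k I) :
  (forall j, bvec k j = \sum_(n < s) a n j *: ws n + ws (r + choice.pickle j)%N) ->
  (forall i j l, Bf (v i) (v j) (v l) = Bg (ws i) (ws j) (ws l)) ->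
  cubic_embeds g f.
Proof.
move=> wsE vE; pose psi j := \sum_(n < s) a n j *: v n + v (r + choice.pickle j)%N.
apply: (@embeds_of_tri psi) => i j l.
pose M := (s + r + choice.pickle i + choice.pickle j + choice.pickle l).+1.
pose co j n := (n < s)%N%:R * a n j + (n == r + choice.pickle j)%N%:R.
have comb (W : lmodType k) (x : nat -> W) j' : (s <= M)%N -> (r + choice.pickle j' < M)%N ->
    \sum_(n < s) a n j' *: x n + x (r + choice.pickle j')%N = \sum_(n < M) co j' n *: x n.
  move=> sM jM; under [RHS]eq_bigr => n _ do rewrite scalerDl.
  rewrite big_split /=; congr (_ + _).
    rewrite (big_ord_widen M (fun n => a n j' *: x n) sM) big_mkcond.
    by apply: eq_bigr => n _; case: ifP; rewrite ?mul1r // mul0r scale0r.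
  rewrite (bigD1 (Ordinal jM)) //= eqxx scale1r big1 ?addr0 // => n.
  by rewrite -val_eqE /= => /negPf->; rewrite scale0r.
rewrite !wsE /psi !comb; try by rewrite /M; lia.
rewrite (tri_sum (pol3_trisym f)) (tri_sum (pol3_trisym g)).
by apply: eq_bigr => x _; apply: eq_bigr => y _; apply: eq_bigr => z _; rewrite vE.
Qed.

Lemma sym3_tri (ws : nat -> vec k J) : sym3 (fun i j l => Bg (ws i) (ws j) (ws l)).
Proof.
have tg := pol3_trisym g; split=> *; [exact: triC12 | exact: triC23].
Qed.

Hypothesis nd : cubic_nondeg f.

Lemma embeds_inf : (forall r, rrk_ge f r) -> cubic_embeds g f.
Proof.
move=> rinf; have tf := pol3_trisym f.
pose ws n := if @choice.unpickle J n is Some j then bvec k j else 0.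
have infK D : exists v, ~ spnK Bf D v.
  apply: NNPP => H; have HD v : spnK Bf D v by apply: NNPP => Hv; apply: H; exists v.
  have [ix ind] := rinf (size D).+1.
  suff: ((size D).+1 <= size D)%N by rewrite ltnn.
  apply: (spnK_indep_leq HD (y := fun j => bvec k (ix j))) => c Kc.
  by apply: ind; apply/derivative_finrk.
have [v vE] := realize_inf tf n2 n3 (nondeg_cosub n2 n3 hf nd) infK (sym3_tri ws).
apply: (@embeds_of_sequence 0 0 (fun _ _ => 0) ws v) => // j.
by rewrite big_ord0 add0r add0n /ws choice.pickleK.
Qed.

(** W is generated by a basis modulo K of size s, padded with zeros up to r, followed by the
    K-components of its basis vectors. From index r on the coefficient slices thus have finite rank,
    as [realize_fin] requires. *)
Lemma embeds_fin r s : rrk_ge f r -> ~ rrk_ge f r.+1 ->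
  rrk_ge g s -> ~ rrk_ge g s.+1 -> (s <= r)%N -> cubic_embeds g f.
Proof.
move=> fr nfr gs ngs sr.
have tf := pol3_trisym f; have tg := pol3_trisym g.
have [xs [cf [szx indx Kf]]] := rrk_span n2 hf fr nfr.
have [ys [cg [szy _ Kg]]] := rrk_span n2 hg gs ngs.
pose xv := [seq bvec k i | i <- xs]; pose yv := [seq bvec k j | j <- ys].
have sKf := finrk_subsp tf.
(* The [cf n] give coordinates modulo K, so their common kernel has finite codimension and lies in
   K. *)
pose U v := forall n, n \in iota 0 r -> lin (cf n) v = 0.
have cU : cosub U by apply: cosub_all => n _; apply: cosub_ker; apply: lin_lfun.
have UK v : U v -> finrk Bf v.
  move=> Uv; suff -> : v = \sum_(i <- finsupp v) v i *: (bvec k i - \sum_(n < r) cf n i *: xv`_n).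
    by apply: (subsp_sum sKf) => i _; apply: (subspZ _ sKf).
  under eq_bigr => i _ do rewrite scalerBr.
  rewrite sumrB -vec_sum [X in _ - X](_ : _ = 0) ?subr0 //.
  under eq_bigr => i _ do rewrite scaler_sumr.
  rewrite exchange_big big1 // => n _ /=.
  under eq_bigr => i _ do rewrite scalerA.
  rewrite -scaler_suml -[X in X *: _]/(lin (cf n) v) Uv ?scale0r //.
  by rewrite mem_iota /=.
pose kv j := bvec k j - \sum_(n < s) cg n j *: yv`_n.
pose ws n := if (n < s)%N then yv`_n else if (n < r)%N then 0 else
  if @choice.unpickle J (n - r)%N is Some j then kv j else 0.
have wsK n : (r <= n)%N -> finrk Bg (ws n).
  move=> rn; rewrite /ws ltnNge (leq_trans sr rn) /= ltnNge rn /=.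
  by case: (choice.unpickle _) => [j|]; [apply: Kg | apply: (finrk_subsp tg).1].
have Gfin n : (size xv <= n)%N -> exists d (l l' : nat -> nat -> k), forall m p,
    Bg (ws n) (ws m) (ws p) = \sum_(j < d) (l j m * l' j p + l' j m * l j p).
  rewrite size_map szx => /wsK[U' cU' U'0].
  have [||d [l [l' [_ _ E]]]] := finite_rank_quad n2 cU' _ _ U'0.
  - by move=> v; apply: (tril2 tg).
  - by move=> u v; apply: (triC23 tg).
  by exists d, (fun j m => l j (ws m)), (fun j m => l' j (ws m)) => m p; rewrite E.
have [v vE] := realize_fin tf n2 n3 (nondeg_cosub n2 n3 hf nd) indx cU UK (sym3_tri ws) Gfin.
apply: (@embeds_of_sequence s r cg ws v) => // j.
have -> : \sum_(n < s) cg n j *: ws n = \sum_(n < s) cg n j *: yv`_n.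
  by apply: eq_bigr => n _; rewrite /ws ltn_ord.
rewrite /ws ltnNge (leq_trans sr (leq_addr _ _)) /= ltnNge leq_addr /= addKn choice.pickleK.
by rewrite /kv addrC subrK.
Qed.

(** Polarization shows that [phi] preserves the trilinear forms. If a combination of images has
    finite rank for f, pulling back the witnessing subspace shows the same for g, so independence
    modulo K is preserved. *)
Lemma embeds_rrk_ge r : cubic_embeds g f -> rrk_ge g r ->
  forall s, rrk_ge f s -> ~ rrk_ge f s.+1 -> (r <= s)%N.
Proof.
move=> [phi [phiL phiE]] [ix ind] s fs nfs.
have tf := pol3_trisym f; have tg := pol3_trisym g.
have phi_lin (a : k) u v : phi (a *: u + v) = a *: phi u + phi v.
  by apply/fsfunP => i; rewrite -vlincomb_lmod phiL vec_coord.
have phiB u v w : Bf (phi u) (phi v) (phi w) = Bg u v w.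
  pose T u v w := Bf (phi u) (phi v) (phi w).
  have tT : trisym T.
    split=> [v' w' a u' u''|u' v' w'|u' v' w']; rewrite /T ?phi_lin.
    - exact: (tril1 tf).
    - exact: (triC12 tf).
    exact: (triC23 tf).
  apply: (tri_eq tT tg (natr6_neq0 n2 n3)) => x.
  by rewrite /T -!evaln3 phiE.
have [xs [cf [szx _ Kf]]] := rrk_span n2 hf fs nfs.
have HD := rrk_span_spnK szx Kf.
have := spnK_indep_leq HD (y := fun j : 'I_r => phi (bvec k (ix j))).
rewrite size_map szx; apply => c [U cU U0]; apply: ind; apply/derivative_finrk => //.
have phi_sum : phi (\sum_j c j *: bvec k (ix j)) = \sum_j c j *: phi (bvec k (ix j)).
  elim: (index_enum _) => [|j e IH]; last by rewrite !big_cons phi_lin IH.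
  rewrite !big_nil; have := phi_lin (-1) 0 0; rewrite scaler0 addr0 scaleN1r.
  by rewrite addNr.
exists (fun v => U (phi v)) => [|v /U0]; last by rewrite -phi_sum phiB.
(* Finite codimension pulls back along [phi]: each cutting functional is composed with it. *)
elim: cU {U0} => {}U => [UT|U' l _ IH ll U'E]; first by apply: cosub_full.
apply: (cosub_cut IH (l := fun v => l (phi v))) => [a u v|v]; last exact: U'E.
by rewrite phi_lin ll.
Qed.

End Embedding.

Theorem theorem1p1 (k : closedFieldType)
  (hk2 : 2%N \notin [pchar k]) (hk3 : 3%N \notin [pchar k])
  (I : choiceType) (f : fpoly k I) (hf : homogp 3 f) (hnd : cubic_nondeg f)
  (J : countType) (g : fpoly k J) (hg : homogp 3 g) :
  cubic_embeds g f <-> le_ninf (rrk g) (rrk f).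
Proof.
have n2 : 2%:R != 0 :> k by move: hk2; rewrite inE.
have n3 : 3%:R != 0 :> k by move: hk3; rewrite inE.
have := is_rrk_rrk f; have := is_rrk_rrk g.
case: (rrk g) => [s|]; case: (rrk f) => [r|] /=.
- move=> [gs ngs] [fr nfr]; split=> [emb|]; last exact: embeds_fin.
  exact: (embeds_rrk_ge n2 n3 hf hg emb gs fr nfr).
- by move=> _ fr; split=> // _; apply: embeds_inf.
- move=> gr [fr nfr]; split=> // emb.
  by have := embeds_rrk_ge n2 n3 hf hg emb (gr r.+1) fr nfr; rewrite ltnn.
by move=> _ fr; split=> // _; apply: embeds_inf.
Qed.
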